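(* Let $T$ be the complete binary tree with $n$ vertices and let $r$ be its root. Then the dispersion time $\tau_{seq}^r(T)$ of Sequential-IDLA on $T$ started from the root is $\Omega(n\log^2 n)$ with probability at least $1-o(1)$; i.e. there is a constant $c>0$ with $\Pr[\tau_{seq}^r(T)\ge c\,n\log^2 n]=1-o(1)$ as $n\to\infty$.
   Context: Sequential-IDLA on a finite connected graph $G$ with $n$ vertices from origin $v$: $n$ particles are released from $v$ one at a time; the first settles at $v$ immediately; each subsequent particle performs a simple random walk from $v$ until it first jumps to a vertex not occupied by a settled particle, where it settles; only then does the next particle start. $\tau_{seq}^v(G)$ (the dispersion time) is the largest number of random walk steps performed by any particle before settling. *)

(* Defs.v *)
From HB Require Import structures.
From mathcomp Require Import all_boot all_order all_algebra.
From mathcomp Require Import all_classical all_reals all_analysis.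

Set Implicit Arguments.
Unset Strict Implicit.
Unset Printing Implicit Defensive.

Import Order.TTheory GRing.Theory Num.Theory.
Import numFieldNormedType.Exports.

Local Open Scope classical_set_scope.
Local Open Scope ring_scope.

(* A finite simple graph is a symmetric irreflexive [e : rel V]. *)
Definition srw_kernel (R : realType) (V : finType) (e : rel V) (x y : V) : R :=
  if e x y then (#|[set z | e x z]%SET|%:R)^-1 else 0.

(* The second clause is the Markov property P(X_(t+1) = y | X_s = w_s, s <= t)
   = p(w_t, y), multiplied by the probability of the conditioning event. *)
Definition simple_random_walk (R : realType) (d : measure_display)
    (Omega : measurableType d) (P : probability Omega R)
    (V : finType) (e : rel V) (v : V) (X : nat -> Omega -> V) : Prop :=
  [/\ forall (t : nat) (x : V), measurable (X t @^-1` [set x]),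
      P (X 0%N @^-1` [set v]) = 1%E &
      forall (t : nat) (w : nat -> V) (y : V),
        P ([set om | forall s, (s <= t)%N -> X s om = w s]
             `&` X t.+1 @^-1` [set y])
        = (P [set om | forall s, (s <= t)%N -> X s om = w s]
             * (srw_kernel R e (w t) y)%:E)%E].

Definition process_sigma_algebra (Omega : Type) (V : finType)
    (X : nat -> Omega -> V) : set (set Omega) :=
  <<s [set A | exists t x, A = X t @^-1` [set x]] >>.

Definition independent_processes (R : realType) (d : measure_display)
    (Omega : measurableType d) (P : probability Omega R)
    (I V : finType) (X : I -> nat -> Omega -> V) : Prop :=
  forall (J : {set I}) (A : I -> set Omega),
    (forall i, i \in J -> process_sigma_algebra (X i) (A i)) ->
    P (\bigcap_(i in [set` J]) A i) = (\prod_(i in J) P (A i))%E.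

(* [X k t] is the position after [t] steps of the walk used by particle [k];
   only the indices [k < #|V|] matter. Each walk is defined for all times, but
   particle [k] follows it only until it settles. *)
Definition idla_walks (R : realType) (d : measure_display)
    (Omega : measurableType d) (P : probability Omega R)
    (V : finType) (e : rel V) (v : V) (X : nat -> nat -> Omega -> V) : Prop :=
  (forall k, (k < #|V|)%N -> simple_random_walk P e v (X k)) /\
  independent_processes P (fun k : 'I_#|V| => X k).

(* First time at which the trajectory [w] is outside [A], [None] if there is no
   such time. A particle released at an unoccupied vertex settles at time 0. *)
Definition settling_time (V : finType) (A : {set V}) (w : nat -> V) :
    option nat :=
  match pselect (exists t, w t \notin A) with
  | left ex => Some (ex_minn ex)
  | right _ => None
  end.

(* Set of vertices occupied after the particles [0, ..., k-1] have settled. A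
   particle that never settles (a null event on a connected graph) is skipped;
   its settling time makes the dispersion time infinite below. *)
Fixpoint occupied (V : finType) (w : nat -> nat -> V) (k : nat) : {set V} :=
  if k is j.+1 then
    let A := occupied w j in
    if settling_time A (w j) is Some t then (w j t |: A)%SET else A
  else finset.set0.

Definition particle_steps (R : realType) (V : finType) (w : nat -> nat -> V)
    (k : nat) : \bar R :=
  if settling_time (occupied w k) (w k) is Some t then (t%:R)%:E else +oo%E.

Definition dispersion_time (R : realType) (V : finType) (w : nat -> nat -> V) :
    \bar R :=
  \big[maxe/0%E]_(k < #|V|) particle_steps R w k.

(* The complete binary tree of height [h], all leaves at depth [h]: a vertex is
   the sequence of left/right choices leading to it from the root. *)
Definition bintree_vertex (h : nat) : finType := {bseq h of bool}.

Definition bintree_root (h : nat) : bintree_vertex h := [bseq].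

Definition bintree_edge (h : nat) : rel (bintree_vertex h) :=
  fun x y => [exists b : bool,
    (y == rcons x b :> seq bool) || (x == rcons y b :> seq bool)].

Lemma card_bintree_vertex (h : nat) : #|bintree_vertex h| = (2 ^ h.+1 - 1)%N.
Proof.
rewrite card_bseq card_bool subn1 predn_exp mul1n.
by apply: eq_bigr => i _.
Qed.

(* Main.v *)
Require Import Defs.
From HB Require Import structures.
From mathcomp Require Import all_boot all_order all_algebra.
From mathcomp Require Import all_classical all_reals all_analysis.
From mathcomp Require Import ring lra zify.

(* The last [m] particles must all walk into one deep subtree. At a vertex [u]
   consider the excursions into the subtrees below its two children: their
   sides are chosen by fair coins, and each subtree is filled by a Markov chain
   that is autonomous when run on its own excursions. When one subtree becomes
   full, the other can have fewer than [m] free vertices only if the numbers of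
   excursions match up to about [m h], and as [d] coin tosses give exactly [i]
   heads with probability at most [1 / sqrt (d + 1)], this has probability at
   most [h m / sqrt M], where [M] is the size of the subtrees. So, for
   [j = h / 16] and [m = 2 ^ (3 j)], with high probability at no vertex of
   depth less than [j] both subtrees are incomplete when only [m] vertices are
   left, hence these lie in one subtree of depth [j]. The time to reach this
   subtree has an almost exponential tail with mean of order [n j]; among [m]
   independent walks some one takes at least [c n (ln n) ^ 2] steps, with an
   error small enough for a union bound over the [2 ^ j] subtrees. *)

Set Implicit Arguments.
Unset Strict Implicit.
Unset Printing Implicit Defensive.

Import Order.TTheory GRing.Theory Num.Theory.
Import numFieldNormedType.Exports.

Local Open Scope classical_set_scope.
Local Open Scope ring_scope.

(** The obstacle is that the last subtree is selected by the same walks whose lengths must be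
    bounded. No conditioning is used: for each fixed subtree it is unlikely that all of the last [m]
    walks visit it within [N] steps, and the union bound absorbs the selection. The coin tosses are
    not constructed on [Omega] either: the absorption probability of an abstract race between two
    Markov chains, extended to the position of the walking particle by [race_walk], is
    superharmonic, so it is a supermartingale from particle to particle. The exponents leave both
    errors of order at most [1 / z] for [z = 2 ^ j]. Since [h - j >= 15 j], the square root of the
    subtree size is at least [z ^ 7], so at most [2 z] races with [m = z ^ 3] fail with total
    probability at most [2 z h z ^ 3 / z ^ 7], where [h <= 16 z]. A walk avoids its target for [N]
    steps with probability at least [1 / (5 z)], and [2 z (1 - 1 / (5 z)) ^ (z ^ 3)] is at most
    [10 / z]. *)

(** * Absorption and exit distributions *)

Definition substochastic (R : realType) (S : finType) (K : S -> S -> R) : Prop :=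
  (forall s t, 0 <= K s t) /\ (forall s, \sum_t K s t <= 1).

Lemma cvgr_sum {R : realType} {I : Type} (r : seq I) (f : I -> nat -> R) (l : I -> R) :
  (forall i, f i n @[n --> \oo] --> l i) ->
  \sum_(i <- r) f i n @[n --> \oo] --> \sum_(i <- r) l i.
Proof.
move=> fl; elim: r => [|i r IH].
  by under eq_fun do rewrite big_nil; rewrite big_nil; exact: cvg_cst.
by under eq_fun do rewrite big_cons; rewrite big_cons; exact: cvgD.
Qed.

Section Absorption.
Context {R : realType} {S : finType}.
Variables (K : S -> S -> R) (stop : pred S) (b : S -> R).

(** Expectation of [b] at the first visit to [stop], counted only if the visit occurs within [n]
    steps. The increasing limit [absorb] solves the Dirichlet problem with boundary values [b]
    without a path space for the chain. *)
Fixpoint absorbn (n : nat) (s : S) : R :=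
  if stop s then b s else
  if n is n'.+1 then \sum_t K s t * absorbn n' t else 0.

Definition absorb (s : S) : R := lim (absorbn n s @[n --> \oo]).

Hypothesis subK : substochastic K.
Hypothesis b01 : forall s, 0 <= b s <= 1.

Lemma absorbn_ge0 n s : 0 <= absorbn n s.
Proof.
elim: n s => [|n IH] s /=; case: ifP => _ //; try by case/andP: (b01 s).
by apply: sumr_ge0 => t _; rewrite mulr_ge0 //; exact: subK.1.
Qed.

Lemma absorbn_le (g : S -> R) n s :
  (forall s, 0 <= g s) -> (forall s, stop s -> b s <= g s) ->
  (forall s, ~~ stop s -> \sum_t K s t * g t <= g s) -> absorbn n s <= g s.
Proof.
move=> g0 gb gK; elim: n s => [|n IH] s /=; case: ifPn => // ns; try exact: gb.
apply: le_trans (gK s ns); apply: ler_sum => t _.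
by rewrite ler_wpM2l //; exact: subK.1.
Qed.

Lemma absorbn_nd s : nondecreasing_seq (fun n => absorbn n s).
Proof.
apply/nondecreasing_seqP => n; elim: n s => [|n IH] s.
  by rewrite /=; case: ifP => // _; apply: sumr_ge0 => t _;
     rewrite mulr_ge0 ?subK.1//; exact: (absorbn_ge0 0).
rewrite /=; case: ifP => // _; apply: ler_sum => t _.
by rewrite ler_wpM2l ?subK.1//; exact: IH.
Qed.

Lemma absorbn_le1 n s : absorbn n s <= 1.
Proof.
apply: (@absorbn_le (fun=> 1)) => // t; first by case/andP: (b01 t).
by move=> _; under eq_bigr do rewrite mulr1; exact: subK.2.
Qed.

Lemma absorb_cvg s : absorbn n s @[n --> \oo] --> absorb s.
Proof.
apply: nondecreasing_is_cvgn; first exact: absorbn_nd.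
by exists 1 => _ [n _ <-]; exact: absorbn_le1.
Qed.

Lemma absorb_ge0 s : 0 <= absorb s.
Proof.
apply: (cvgr_to_ge (@absorb_cvg s)); apply: nearW => n; exact: absorbn_ge0.
Qed.

Lemma absorb_bound s c : (forall n, absorbn n s <= c) -> absorb s <= c.
Proof. by move=> H; apply: (cvgr_to_le (@absorb_cvg s)); apply: nearW. Qed.

Lemma absorb_stop s : stop s -> absorb s = b s.
Proof.
move=> ss; apply: (@cvg_unique _ _ (absorbn n s @[n --> \oo])) => //.
  exact: absorb_cvg.
by rewrite (_ : absorbn ^~ s = cst (b s)); [exact: cvg_cst|
  apply/funext => -[|n] /=; rewrite ss].
Qed.

Lemma absorb_step s : ~~ stop s -> absorb s = \sum_t K s t * absorb t.
Proof.
move=> ns; apply: (@cvg_unique _ _ (absorbn n.+1 s @[n --> \oo])) => //.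
  by have := @absorb_cvg s; rewrite -cvg_shiftS; exact.
rewrite (_ : (fun n => _) = (fun n => \sum_t K s t * absorbn n t)).
  by apply: cvgr_sum => t; apply: cvgMr; exact: absorb_cvg.
by apply/funext => n /=; rewrite (negbTE ns).
Qed.

End Absorption.

Section Hit.
Context {R : realType} {V : finType}.
Variable p : V -> V -> R.
Hypothesis subp : substochastic p.

(* [hit D y x] is the probability that the chain started at [y] leaves [D],
   and does so at [x]. *)
Definition hit (D : {set V}) (y x : V) : R :=
  absorb p (fun z => z \notin D) (fun z => (z == x)%:R) y.

Let b01 (x z : V) : 0 <= ((z == x)%:R : R) <= 1.
Proof. by case: eqP => _; rewrite ?lexx ?ler01. Qed.

Lemma hit_ge0 D y x : 0 <= hit D y x.
Proof. exact: absorb_ge0. Qed.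

Lemma hit_out (D : {set V}) y (F : V -> R) : y \notin D -> \sum_x hit D y x * F x = F y.
Proof.
move=> yD; rewrite (bigD1 y)//= big1 => [|x /negPf xy]; last first.
  by rewrite /hit absorb_stop// eq_sym xy mul0r.
by rewrite /hit absorb_stop// eqxx mul1r addr0.
Qed.

Lemma hit_in (D : {set V}) y (F : V -> R) : y \in D ->
  \sum_x hit D y x * F x = \sum_z p y z * \sum_x hit D z x * F x.
Proof.
move=> yD; under [RHS]eq_bigr do rewrite mulr_sumr.
rewrite exchange_big/=; apply: eq_bigr => x _.
rewrite {1}/hit absorb_step ?yD// mulr_suml.
by apply: eq_bigr => z _; rewrite mulrA.
Qed.

(** Optional stopping for a function superharmonic on [D], proved by induction on the truncation
    time. Mass that has not yet left [D] contributes zero on the left, which [0 <= g] covers. *)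
Lemma hit_le (D : {set V}) y (F g : V -> R) :
  (forall x, 0 <= F x) -> (forall x, 0 <= g x) ->
  (forall x, x \notin D -> F x <= g x) ->
  (forall x, x \in D -> \sum_z p x z * g z <= g x) ->
  \sum_x hit D y x * F x <= g y.
Proof.
move=> F0 g0 Fg gD.
pose hn n y x := absorbn p (fun z => z \notin D) (fun z => (z == x)%:R) n y.
have cv : \sum_x hn n y x * F x @[n --> \oo] --> \sum_x hit D y x * F x.
  apply: cvgr_sum => x; apply: cvgMl; apply: absorb_cvg => //.
have hn_out n x : x \notin D -> \sum_z hn n x z * F z <= g x.
  move=> xD; apply: le_trans (Fg _ xD).
  have hnE z : hn n x z = (x == z)%:R by case: n => [|n]; rewrite /hn /= xD.
  rewrite (bigD1 x)//= big1 => [|z /negPf zx]; rewrite hnE.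
    by rewrite eqxx mul1r addr0.
  by rewrite eq_sym zx mul0r.
apply: (cvgr_to_le cv); apply: nearW => n; elim: n y {cv} => [|n IH] y.
  have [yD|] := boolP (y \in D); last exact: hn_out.
  by rewrite big1// => x _; rewrite /hn/= yD mul0r.
have [yD|] := boolP (y \in D); last exact: hn_out.
apply: le_trans (gD _ yD).
rewrite (_ : \sum_x _ = \sum_z p y z * \sum_x hn n z x * F x).
  by apply: ler_sum => z _; rewrite ler_wpM2l// subp.1.
under [RHS]eq_bigr do rewrite mulr_sumr.
rewrite exchange_big/=; apply: eq_bigr => x _.
rewrite {1}/hn/= yD/= mulr_suml.
by apply: eq_bigr => z _; rewrite mulrA.
Qed.

Lemma hit_le1 D y : \sum_x hit D y x <= 1.
Proof.
have := @hit_le D y (fun=> 1) (fun=> 1).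
under eq_bigr do rewrite mulr1; apply => // x _.
by under eq_bigr do rewrite mulr1; exact: subp.2.
Qed.

End Hit.

(** * Two killed chains driven by coin tosses *)

(** The factor [2 k + 1] lets the induction close: the ratio of consecutive left sides is
    [4 (2 k + 1) (2 k + 3) / (k + 1) ^ 2], which is at most 16. *)
Lemma central_bin_sq_bound k : ('C(k.*2, k) ^ 2 * k.*2.+1 <= 4 ^ k.*2)%N.
Proof.
elim: k => // k IH.
have e1 := mul_bin_diag k.*2.+2 k; have e2 := mul_bin_diag k.*2.+1 k.
have e3 : 'C(k.*2.+1, k) = 'C(k.*2.+1, k.+1).
  by rewrite -bin_sub; [congr 'C(_, _)|]; lia.
rewrite /= in e1 e2; rewrite doubleS !expnS.
move: e1 e2 IH; rewrite e3.
move: ('C(_, _)) ('C(_, _)) ('C(_, _)) (4 ^ _)%N => c b a q e1 e2 IH.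
have e4 : (k.+1 * b = 2 * (k.*2.+1 * c))%N by rewrite -!muln2 in e1 e2 *; lia.
rewrite expn0 muln1 -(leq_pmul2l (_ : 0 < k.+1 * k.+1)%N)//.
have -> : (k.+1 * k.+1 * (b * b * k.*2.+3) = 4 * (k.*2.+1 * k.*2.+3) * (c ^ 2 * k.*2.+1))%N.
  rewrite (_ : _ * _ = (k.+1 * b) * (k.+1 * b) * k.*2.+3)%N; last by lia.
  by rewrite e4 -mulnn; lia.
have : (k.*2.+1 * k.*2.+3 <= 4 * (k.+1 * k.+1))%N by nia.
move=> h1; have := leq_mul h1 IH; lia.
Qed.

(** By symmetry let [k <= i], and move away from the central coefficient by raising [i]. With
    [n = i + k], one such step multiplies the left side by [(n + 1) (n + 2) / (i + 1) ^ 2], at most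
    4 because [n <= 2 i]. *)
Lemma bin_sq_bound i k : ('C(i + k, i) ^ 2 * (i + k).+1 <= 4 ^ (i + k))%N.
Proof.
wlog ki : i k / (k <= i)%N => [hw|].
  have [/hw//|/ltnW ii] := leqP k i.
  by rewrite addnC -bin_sub ?leq_addl// addnK hw.
move/subnK: ki; move: (i - k)%N => j <-; elim: j => [|j IH].
  by rewrite add0n addnn central_bin_sq_bound.
have e1 := mul_bin_diag (j + k + k).+1 (j + k).
rewrite /= in e1; rewrite !addSn (expnS 4).
move: IH e1; move: ('C(_, _)) ('C(_, _)) (4 ^ _)%N => b a q IH e1.
rewrite -(leq_pmul2l (_ : 0 < (j + k).+1 * (j + k).+1)%N)//.
have -> : ((j + k).+1 * (j + k).+1 * (b ^ 2 * (j + k + k).+2) =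
  (j + k + k).+1 * (j + k + k).+2 * (a ^ 2 * (j + k + k).+1))%N.
  rewrite (_ : (_ * _ * _)%N = (((j + k).+1 * b) * ((j + k).+1 * b) * (j + k + k).+2)%N).
    by rewrite -e1 -mulnn; lia.
  by rewrite -mulnn; lia.
have : ((j + k + k).+1 * (j + k + k).+2 <= 4 * ((j + k).+1 * (j + k).+1))%N by nia.
move=> h1; have := leq_mul h1 IH; lia.
Qed.

Lemma binomial_weight_le (R : realType) (M d i : nat) : (0 < M)%N ->
  (M <= d.+1)%N -> (i <= d)%N -> 'C(d, i)%:R / 2 ^+ d <= (Num.sqrt M%:R)^-1 :> R.
Proof.
move=> M0 Md id; rewrite ler_pdivrMr ?exprn_gt0// mulrC.
have s0 : 0 < Num.sqrt M%:R :> R by rewrite sqrtr_gt0 ltr0n.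
rewrite ler_pdivlMr// -(@ler_pXn2r _ 2)// ?nnegrE ?mulr_ge0 ?exprn_ge0//.
rewrite exprMn sqr_sqrtr ?ler0n// -!natrX -natrM ler_nat.
have := bin_sq_bound i (d - i); rewrite subnKC// => h.
rewrite -expnM [(d * 2)%N]mulnC expnM; apply: leq_trans h.
by rewrite leq_mul2l Md orbT.
Qed.

Section KilledChain.
Context {R : realType} {S : finType}.
Variables (K : S -> S -> R) (full near : pred S) (s0 : S).
Hypothesis subK : substochastic K.
Hypothesis s0_nfull : ~~ full s0.

(** Law after [n] steps from [s0], restricted to the paths that have not yet met [full]. *)
Fixpoint killed (n : nat) (t : S) : R :=
  if full t then 0 else
  if n is n'.+1 then \sum_s killed n' s * K s t else (t == s0)%:R.

(** Probability that the chain first becomes full at step [n + 1]; the shift explains the condition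
    [n.+1 < M] in [arrival_early]. *)
Definition arrival (n : nat) : R := \sum_(t | full t) \sum_s killed n s * K s t.

Definition near_mass (n : nat) : R := \sum_t killed n t * (near t)%:R.

Lemma killed_full n t : full t -> killed n t = 0.
Proof. by case: n => [|n] /= ->. Qed.

Lemma killed_ge0 n t : 0 <= killed n t.
Proof.
elim: n t => [|n IH] t /=; case: ifP => // _.
by apply: sumr_ge0 => s _; rewrite mulr_ge0// subK.1.
Qed.

Lemma arrival_ge0 n : 0 <= arrival n.
Proof.
by apply: sumr_ge0 => t _; apply: sumr_ge0 => s _; rewrite mulr_ge0 ?killed_ge0// subK.1.
Qed.

Lemma near_mass_ge0 n : 0 <= near_mass n.
Proof. by apply: sumr_ge0 => t _; rewrite mulr_ge0 ?killed_ge0. Qed.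

Lemma killed_step n (f : S -> R) :
  \sum_s killed n s * \sum_t K s t * f t =
  \sum_t killed n.+1 t * f t + \sum_(t | full t) (\sum_s killed n s * K s t) * f t.
Proof.
under eq_bigr do rewrite mulr_sumr.
rewrite exchange_big/= [RHS]addrC [LHS](bigID full)/=; congr (_ + _).
  by apply: eq_bigr => t _; rewrite mulr_suml; apply: eq_bigr => s _; rewrite mulrA.
rewrite [RHS](bigID full)/= [X in _ = X + _]big1 ?add0r => [|t ft]; last first.
  by rewrite ft mul0r.
apply: eq_bigr => t /negPf ->; rewrite mulr_suml.
by apply: eq_bigr => s _; rewrite mulrA.
Qed.

Lemma killed_step_le n (f : S -> R) (c : R) : (forall t, full t -> f t <= c) ->
  \sum_s killed n s * \sum_t K s t * f t <= \sum_t killed n.+1 t * f t + arrival n * c.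
Proof.
move=> fc; rewrite killed_step lerD2l mulr_suml; apply: ler_sum => t ft.
rewrite ler_wpM2l ?fc//; apply: sumr_ge0 => s _.
by rewrite mulr_ge0 ?killed_ge0// subK.1.
Qed.

Lemma killed0_sum (f : S -> R) : \sum_s killed 0 s * f s = f s0.
Proof.
rewrite (bigD1 s0)//= big1 => [|s /negPf ss]; last by rewrite ss if_same mul0r.
by rewrite (negPf s0_nfull) eqxx mul1r addr0.
Qed.

Lemma sum_arrival_le1 N : \sum_(n < N) arrival n <= 1.
Proof.
suff : \sum_(n < N) arrival n + \sum_s killed N s * 1 <= 1.
  apply: le_trans; rewrite lerDl; apply: sumr_ge0 => s _.
  by rewrite mulr1 killed_ge0.
elim: N => [|N IH]; first by rewrite big_ord0 add0r killed0_sum.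
apply: le_trans IH; rewrite big_ord_recr/= -addrA lerD2l addrC.
have := killed_step N (fun=> 1); under [X in _ + X]eq_bigr do rewrite mulr1.
move=> <-; apply: ler_sum => s _; rewrite ler_wpM2l ?killed_ge0//.
by under eq_bigr do rewrite mulr1; exact: subK.2.
Qed.

Lemma arrival_early (size : S -> nat) (M n : nat) : size s0 = 0%N ->
  (forall s t, K s t != 0 -> (size t <= (size s).+1)%N) ->
  (forall t, full t -> (M <= size t)%N) -> (n.+1 < M)%N -> arrival n = 0.
Proof.
move=> sz0 szK szF nM.
have H s : killed n s != 0 -> (size s <= n)%N.
  elim: n {nM} s => [|n IH] s /=; case: ifP => _; rewrite ?eqxx//.
    by have [->|_] := eqVneq s s0; rewrite ?sz0// eqxx.
  move=> /eqP H; have [|t /andP[_]] := psumr_neq0P _ H.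
    by move=> t _; rewrite mulr_ge0 ?killed_ge0// subK.1.
  move=> /lt0r_neq0; rewrite mulf_eq0 negb_or => /andP[/IH h1 /szK h2].
  exact: leq_trans h2 _.
rewrite /arrival big1// => t /szF ft; rewrite big1// => s _.
have [->|/H h1] := eqVneq (killed n s) 0; first by rewrite mul0r.
have [->|/szK h2] := eqVneq (K s t) 0; first by rewrite mulr0.
by move: nM; rewrite ltnNge (leq_trans ft)// (leq_trans h2).
Qed.

(** A Lyapunov bound on the expected time spent near before becoming full: [psi] drops on average by
    at least one at each such time, so the time already spent plus the mean of [psi] over the
    surviving paths never increases. *)
Lemma sum_near_mass_le (psi : S -> R) N : (forall s, 0 <= psi s) ->
  (forall s, ~~ full s -> \sum_t K s t * psi t + (near s)%:R <= psi s) ->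
  \sum_(n < N) near_mass n <= psi s0.
Proof.
move=> psi0 psiK.
suff : \sum_(n < N) near_mass n + \sum_s killed N s * psi s <= psi s0.
  apply: le_trans; rewrite lerDl; apply: sumr_ge0 => s _.
  by rewrite mulr_ge0 ?killed_ge0.
elim: N => [|N IH]; first by rewrite big_ord0 add0r killed0_sum.
apply: le_trans IH; rewrite big_ord_recr/= -addrA lerD2l.
apply: (@le_trans _ _ (near_mass N + \sum_s killed N s * \sum_t K s t * psi t)).
  rewrite lerD2l killed_step lerDl; apply: sumr_ge0 => t _.
  by rewrite mulr_ge0//; apply: sumr_ge0 => s _; rewrite mulr_ge0 ?killed_ge0// subK.1.
rewrite -big_split/=; apply: ler_sum => s _.
have [fs|fs] := boolP (full s); first by rewrite killed_full// !mul0r addr0.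
by rewrite -mulrDr addrC ler_wpM2l ?killed_ge0// psiK.
Qed.

End KilledChain.

Lemma sum_triangle_le {R : realType} (a b : nat -> R) N :
  (forall i, 0 <= a i) -> (forall i, 0 <= b i) ->
  \sum_(e < N) \sum_(i < e.+1) a i * b (e - i)%N <= (\sum_(i < N) a i) * \sum_(k < N) b k.
Proof.
move=> a0 b0.
rewrite (eq_bigr (fun e : 'I_N => \sum_(i < N | (i <= e)%N) a i * b (e - i)%N)); last first.
  by move=> e _; rewrite (big_ord_widen_cond N (fun=> true) (fun i => a i * b (e - i)%N)).
rewrite (exchange_big_dep predT)//= mulr_suml; apply: ler_sum => i _.
rewrite -mulr_sumr ler_wpM2l//.
rewrite -(big_mkord (fun e => predT e && (i <= e)%N) (fun e => b (e - i)%N)).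
rewrite -(big_mkord predT b) -big_nat_widenl ?leq0n// -{1}[nat_of_ord i]add0n big_addn.
rewrite [leRHS](@big_cat_nat _ _ _ (N - i) 0 N)/= ?leq_subr//.
rewrite (eq_bigr (fun k => b k)) => [|k _]; last by rewrite addnK.
rewrite [leLHS](_ : _ = \sum_(0 <= k < N - i) b k)// lerDl; exact: sumr_ge0.
Qed.

Section Race.
Context {R : realType} {S1 S2 : finType}.
Variables (K1 : S1 -> S1 -> R) (K2 : S2 -> S2 -> R).
Variables (full1 near1 : pred S1) (full2 near2 : pred S2).
Hypotheses (subK1 : substochastic K1) (subK2 : substochastic K2).

Definition race_kernel (s t : S1 * S2) : R :=
  (K1 s.1 t.1 * (t.2 == s.2)%:R + K2 s.2 t.2 * (t.1 == s.1)%:R) / 2.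
Definition race_stop (s : S1 * S2) := full1 s.1 || full2 s.2.
Definition race_near (s : S1 * S2) : R := (near1 s.1 && near2 s.2)%:R.
Definition race := absorb race_kernel race_stop race_near.

Lemma race_kernel_sum s (f : S1 * S2 -> R) :
  \sum_t race_kernel s t * f t =
  (\sum_t K1 s.1 t * f (t, s.2) + \sum_t K2 s.2 t * f (s.1, t)) / 2.
Proof.
rewrite (eq_bigr (fun t => race_kernel s (t.1, t.2) * f (t.1, t.2))) => [|[]//].
rewrite mulrDl !mulr_suml -(pair_bigA _ (fun i j => race_kernel s (i, j) * f (i, j)))/=.
under eq_bigr do under eq_bigr do rewrite /race_kernel/= mulrDl mulrDl.
under eq_bigr do rewrite big_split/=.
rewrite big_split/=; congr (_ + _).
  apply: eq_bigr => t _; rewrite (bigD1 s.2)//= big1 => [|i /negPf ->]; last first.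
    by rewrite mulr0 !mul0r.
  by rewrite eqxx mulr1 addr0 mulrAC.
rewrite exchange_big/=.
apply: eq_bigr => t _; rewrite (bigD1 s.1)//= big1 => [|i /negPf ->]; last first.
  by rewrite mulr0 !mul0r.
by rewrite eqxx mulr1 addr0 mulrAC.
Qed.

Lemma race_kernel_sub : substochastic race_kernel.
Proof.
split=> [s t|s].
  by rewrite divr_ge0// addr_ge0// mulr_ge0// ?subK1.1 ?subK2.1.
have := race_kernel_sum s (fun=> 1); under eq_bigr do rewrite mulr1.
move=> ->; under eq_bigr do rewrite mulr1.
under [X in _ + X]eq_bigr do rewrite mulr1.
have := subK1.2 s.1; have := subK2.2 s.2; lra.
Qed.

Lemma race_near01 s : 0 <= race_near s <= 1.
Proof. by rewrite /race_near ler0n lern1 leq_b1. Qed.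

Variables (s1 : S1) (s2 : S2).
Hypotheses (s1_nfull : ~~ full1 s1) (s2_nfull : ~~ full2 s2).
Variables (M : nat) (G : R).
Hypothesis M_gt0 : (0 < M)%N.
Let k1 := killed K1 full1 s1.
Let k2 := killed K2 full2 s2.
Let a1 := arrival K1 full1 s1.
Let a2 := arrival K2 full2 s2.
Let m1 := near_mass K1 full1 near1 s1.
Let m2 := near_mass K2 full2 near2 s2.
Hypothesis a1_early : forall n, (n.+1 < M)%N -> a1 n = 0.
Hypothesis a2_early : forall n, (n.+1 < M)%N -> a2 n = 0.
Hypothesis m1_le : forall N, \sum_(n < N) m1 n <= G.
Hypothesis m2_le : forall N, \sum_(n < N) m2 n <= G.

Let rn N s t := absorbn race_kernel race_stop race_near N (s, t).
(** The race with [N] tosses left, averaged over the laws of the two chains after [i] and [k] steps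
    of their own, both still running. Since the chains do not interact, only the two step counts
    have to be remembered. *)
Let W N i k := \sum_s k1 i s * \sum_t k2 k t * rn N s t.

Let W0 i k : W 0 i k = 0.
Proof.
rewrite /W big1// => s _; have [fs|fs] := boolP (full1 s).
  by rewrite /k1 killed_full// mul0r.
rewrite big1 ?mulr0// => t _; have [ft|ft] := boolP (full2 t).
  by rewrite /k2 killed_full// mul0r.
by rewrite /rn/= /race_stop/= (negPf fs) (negPf ft) mulr0.
Qed.

Let W_comm N i k : W N i k = \sum_t k2 k t * \sum_s k1 i s * rn N s t.
Proof.
rewrite /W; under eq_bigr do rewrite mulr_sumr.
rewrite exchange_big/=; apply: eq_bigr => t _; rewrite mulr_sumr.
by apply: eq_bigr => s _; rewrite mulrCA.
Qed.

(** A toss moves one chain. Either that chain keeps running, or it becomes full, and then the race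
    pays at most 1, and only if the other chain is near. *)
Let W_rec N i k : W N.+1 i k <=
  (W N i.+1 k + W N i k.+1) / 2 + (a1 i * m2 k + m1 i * a2 k) / 2.
Proof.
pose A s t := \sum_s' K1 s s' * rn N s' t.
pose B s t := \sum_t' K2 t t' * rn N s t'.
have -> : W N.+1 i k =
    (\sum_t k2 k t * (\sum_s k1 i s * A s t)
     + \sum_s k1 i s * (\sum_t k2 k t * B s t)) / 2.
  have -> : \sum_t k2 k t * (\sum_s k1 i s * A s t) = \sum_s k1 i s * (\sum_t k2 k t * A s t).
    under eq_bigr do rewrite mulr_sumr.
    rewrite exchange_big/=; apply: eq_bigr => t _; rewrite mulr_sumr.
    by apply: eq_bigr => s _; rewrite mulrCA.
  rewrite -big_split/= mulr_suml; apply: eq_bigr => s _.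
  have [fs|fs] := boolP (full1 s); first by rewrite /k1 killed_full// !mul0r addr0 mul0r.
  rewrite -mulrDr -big_split/= -mulrA mulr_suml; congr (_ * _); apply: eq_bigr => t _.
  have [ft|ft] := boolP (full2 t); first by rewrite /k2 killed_full// !mul0r addr0 mul0r.
  rewrite {1}/rn/= {1}/race_stop/= (negPf fs) (negPf ft)/= race_kernel_sum/=.
  by rewrite -mulrDr mulrA.
have rF1 s t : full1 s -> rn N s t <= (near2 t)%:R.
  move=> fs; rewrite /rn; case: N {A B} => [|N] /=; rewrite /race_stop/= fs /= /race_near/= ler_nat;
  by case: (near1 s); case: (near2 t).
have rF2 s t : full2 t -> rn N s t <= (near1 s)%:R.
  move=> fs; rewrite /rn; case: N {A B rF1} => [|N] /=;
  rewrite /race_stop/= fs orbT /= /race_near/= ler_nat;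
  by case: (near1 s); case: (near2 t).
have h1 : \sum_t k2 k t * (\sum_s k1 i s * A s t) <= W N i.+1 k + a1 i * m2 k.
  rewrite W_comm /m2 /near_mass mulr_sumr -big_split/=; apply: ler_sum => t _.
  rewrite mulrCA -mulrDr ler_wpM2l ?killed_ge0//.
  by apply: killed_step_le => // s; exact: rF1.
have h2 : \sum_s k1 i s * (\sum_t k2 k t * B s t) <= W N i k.+1 + m1 i * a2 k.
  rewrite /W /m1 /near_mass mulr_suml -big_split/=; apply: ler_sum => s _.
  rewrite -mulrA -mulrDr ler_wpM2l ?killed_ge0//.
  by rewrite [(_)%:R * _]mulrC; apply: killed_step_le => // t; exact: rF2.
by rewrite -mulrDl ler_wpM2r// (le_trans (lerD h1 h2))// addrACA.
Qed.

(* After [d] excursions, [i] of them were made by the first chain with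
   probability ['C(d, i) / 2 ^ d]. *)
Let w d i : R := 'C(d, i)%:R / 2 ^+ d.
Let D N d := \sum_(i < d.+1) w d i * W N i (d - i)%N.
Let c i k := a1 i * m2 k + m1 i * a2 k.

Let D_rec N d : D N.+1 d <= D N d.+1 + (\sum_(i < d.+1) w d i * c i (d - i)%N) / 2.
Proof.
have w0 e i : 0 <= w e i by rewrite divr_ge0// exprn_ge0.
apply: (@le_trans _ _ (\sum_(i < d.+1) w d i *
    ((W N i.+1 (d - i) + W N i (d - i).+1) / 2 + c i (d - i)%N / 2))).
  by apply: ler_sum => i _; rewrite ler_wpM2l// W_rec.
rewrite mulr_suml (eq_bigr (fun i : 'I_d.+1 =>
    w d i * ((W N i.+1 (d - i) + W N i (d - i).+1) / 2) + w d i * c i (d - i)%N / 2)); last first.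
  by move=> i _; ring.
rewrite big_split/= lerD2r /D.
rewrite (eq_bigr (fun i : 'I_d.+1 =>
    w d i * W N i.+1 (d - i) / 2 + w d i * W N i (d - i).+1 / 2)); last first.
  by move=> i _; ring.
rewrite big_split/= [X in _ + X <= _]big_ord_recl/= subn0 [leRHS]big_ord_recl/= subn0.
(* Pascal's rule splits the weight of [i + 1] heads in [d + 1] tosses according to the last toss. *)
rewrite [X in _ <= _ + X](eq_bigr (fun i : 'I_d.+1 =>
    w d i.+1 * W N i.+1 (d - i) / 2 + w d i * W N i.+1 (d - i) / 2)); last first.
  move=> i _; rewrite /bump/= add1n subSS /w binS natrD exprS invfM; field.
  by rewrite expf_neq0.
rewrite [in leRHS]big_split/= [X in _ <= _ + (X + _)]big_ord_recr/=.
have -> : w d d.+1 = 0 by rewrite /w bin_small// mul0r.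
rewrite !mul0r addr0 [leRHS]addrA [leLHS]addrC lerD2r lerD//.
  by rewrite /w !bin0 exprS invfM mul1r mul1r mulrAC [2^-1 * _]mulrC.
apply: ler_sum => i _; rewrite /bump/= add1n.
by rewrite subnSK.
Qed.

Let D_le N d : D N d <=
  \sum_(e < N) (\sum_(i < (d + e).+1) w (d + e) i * c i (d + e - i)%N) / 2.
Proof.
elim: N d => [|N IH] d.
  by rewrite big_ord0 /D big1// => i _; rewrite W0 mulr0.
rewrite big_ord_recl/= addn0 addrC; apply: le_trans (D_rec N d) _.
rewrite lerD2r; apply: le_trans (IH d.+1) _.
by apply: ler_sum => i _; rewrite /bump/= add1n addSnnS.
Qed.

(** A chain cannot become full before its step [M], so every contributing term has at least [M - 1]
    earlier tosses and a binomial weight of at most [1 / sqrt M]. Once this weight is pulled out,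
    the sums over step counts are bounded by products of a total arrival probability, at most 1, and
    a total near time, at most [G]. The two symmetric products are halved by the final toss. *)
Lemma race_le : race (s1, s2) <= G / Num.sqrt M%:R.
Proof.
apply: absorb_bound => [||N]; [exact: race_kernel_sub|exact: race_near01|].
have -> : absorbn race_kernel race_stop race_near N (s1, s2) = D N 0.
  rewrite /D big_ord1 subnn /w bin0 expr0 divr1 mul1r /W /k1 killed0_sum//.
  by rewrite /k2 killed0_sum.
apply: le_trans (D_le _ _) _.
have a10 := arrival_ge0 full1 s1 subK1; have a20 := arrival_ge0 full2 s2 subK2.
have m10 := near_mass_ge0 full1 near1 s1 subK1; have m20 := near_mass_ge0 full2 near2 s2 subK2.
set rho := (Num.sqrt M%:R)^-1; have rho0 : 0 <= rho by rewrite invr_ge0 sqrtr_ge0.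
pose T (a b : nat -> R) := \sum_(e < N) \sum_(i < e.+1) a i * b (e - i)%N.
apply: (@le_trans _ _ (rho * (T a1 m2 + T m1 a2) / 2)).
  rewrite /T -big_split/= mulr_sumr mulr_suml; apply: ler_sum => e _.
  rewrite add0n ler_wpM2r// -big_split/= mulr_sumr; apply: ler_sum => i _.
  have wr : (M <= e.+1)%N -> w e i <= rho.
    by move=> Me; apply: binomial_weight_le => //; rewrite -ltnS.
  rewrite /c 2!mulrDr; apply: lerD.
    have [/a1_early ->|Mi] := ltnP i.+1 M; first by rewrite !mul0r !mulr0.
    by rewrite ler_wpM2r ?mulr_ge0// wr// (leq_trans Mi).
  have [/a2_early ->|Mi] := ltnP (e - i).+1 M; first by rewrite !mulr0.
  by rewrite ler_wpM2r ?mulr_ge0// wr// (leq_trans Mi)// ltnS leq_subr.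
have G0 : 0 <= G by have := m1_le 0; rewrite big_ord0.
have T1 : T a1 m2 <= G.
  apply: le_trans (sum_triangle_le _ a10 m20) _.
  apply: le_trans (ler_pM _ _ (sum_arrival_le1 subK1 s1_nfull N) (m2_le N)) _;
    rewrite ?mul1r//; exact: sumr_ge0.
have T2 : T m1 a2 <= G.
  apply: le_trans (sum_triangle_le _ m10 a20) _.
  apply: le_trans (ler_pM _ _ (m1_le N) (sum_arrival_le1 subK2 s2_nfull N)) _;
    rewrite ?mulr1//; exact: sumr_ge0.
rewrite -mulrA [X in _ <= X]mulrC ler_wpM2l//; lra.
Qed.

End Race.

(** * The race between two branches *)

(** The single entrance [l] is what makes the filling of [L] autonomous: all excursions start at the
    same vertex, so the outcome of one depends on the past only through the occupied part of [L]. *)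
Definition branch {R : realType} {V : finType} (p : V -> V -> R) (u l : V)
    (L : {set V}) : Prop :=
  [/\ u \notin L, l \in L,
      forall y z, y \in L -> p y z != 0 -> z \in L \/ z = u &
      forall y z, y \notin L -> z \in L -> p y z != 0 -> y = u /\ z = l].

Section Filling.
Context {R : realType} {V : finType}.
Variables (p : V -> V -> R) (l : V) (L : {set V}).
Hypothesis subp : substochastic p.

(* One excursion into the branch [L]: either it fills the vertex [x] of [L],
   or it returns without changing the occupied set [A]. *)
Definition fill_kernel (A A' : {set V}) : R :=
  \sum_x hit p (A :&: L)%SET l x * (((x |: A) :&: L)%SET == A')%:R.

Definition full : pred {set V} := fun A => L \subset A.
Definition near (m : nat) : pred {set V} := fun A => (#|L :\: A| < m)%N.

Lemma fill_kernel_sum A (f : {set V} -> R) :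
  \sum_A' fill_kernel A A' * f A' =
  \sum_x hit p (A :&: L)%SET l x * f ((x |: A) :&: L)%SET.
Proof.
under eq_bigr do rewrite mulr_suml.
rewrite exchange_big/=; apply: eq_bigr => x _.
rewrite (bigD1 ((x |: A) :&: L)%SET)//= big1 => [|B /negPf BA]; last first.
  by rewrite eq_sym BA mulr0 mul0r.
by rewrite eqxx mulr1 addr0.
Qed.

Lemma fill_kernel_ge0 A A' : 0 <= fill_kernel A A'.
Proof. by apply: sumr_ge0 => x _; rewrite mulr_ge0// hit_ge0. Qed.

Lemma fill_kernel_sub : substochastic fill_kernel.
Proof.
split=> [A A'|A]; first exact: fill_kernel_ge0.
have := fill_kernel_sum A (fun=> 1); under eq_bigr do rewrite mulr1.
by move=> ->; under eq_bigr do rewrite mulr1; exact: hit_le1.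
Qed.

Variables (M m : nat) (H : R).
Hypothesis card_L : (M <= #|L|)%N.
Hypothesis L_gt0 : (0 < #|L|)%N.
Hypothesis H_gt0 : 0 < H.
Hypothesis escape : forall A : {set V}, ~~ (L \subset A) ->
  \sum_(x | x \notin (L :\: A)%SET) hit p (A :&: L)%SET l x <= 1 - H^-1.

Lemma set0_nfull : ~~ full finset.set0.
Proof. by rewrite /full finset.subset0 -cards_eq0 -lt0n. Qed.

Lemma fill_arrival_early n : (n.+1 < M)%N -> arrival fill_kernel full finset.set0 n = 0.
Proof.
apply: (arrival_early fill_kernel_sub (size := fun A => #|A :&: L|)).
- by rewrite finset.set0I cards0.
- move=> A A' /eqP; have [x /eqP <- _|nx] := pickP (fun x => ((x |: A) :&: L)%SET == A').
    rewrite -finset.setIA finset.setIid finset.setIUl -add1n.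
    apply: leq_trans (leq_card_setU _ _) _; rewrite leq_add2r.
    by rewrite -(cards1 x) subset_leq_card// finset.subsetIl.
  by rewrite /fill_kernel big1// => x _; have := nx x; rewrite /= => ->; rewrite mulr0.
- by move=> A /finset.setIidPr ->.
Qed.

Lemma fill_near_mass N : \sum_(n < N) near_mass fill_kernel full (near m) finset.set0 n <= H * m%:R.
Proof.
(* An excursion fails to fill a vertex with probability at most [1 - 1 / H], so each number of free
   vertices below [m] lasts at most [H] excursions in the mean. The truncation at [m] makes the
   bound independent of the size of [L]. *)
pose psi (A : {set V}) : R := H * (minn #|L :\: A| m)%:R.
apply: (@le_trans _ _ (psi finset.set0)); last first.
  by rewrite /psi ler_wpM2l ?(ltW H_gt0)// ler_nat geq_minr.
apply: sum_near_mass_le => [||A|A nA]; [exact: fill_kernel_sub|exact: set0_nfull| |].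
  by rewrite mulr_ge0// ltW.
have psiE x : psi ((x |: A) :&: L)%SET = H * (minn (#|L :\: A| - (x \in L :\: A)) m)%:R.
  rewrite /psi; congr (_ * (minn _ _)%:R).
  rewrite [in RHS](cardsD1 x (L :\: A)) addKn; apply: eq_card => y; rewrite !inE.
  by case: (y \in L); rewrite ?andbT ?andbF//= negb_or.
have c0 : (0 < #|L :\: A|)%N by rewrite card_gt0 finset.setD_eq0.
rewrite fill_kernel_sum; under eq_bigr do rewrite psiE.
rewrite /near; case: ltnP => cm /=; last first.
  rewrite addr0 /psi (minn_idPr cm).
  apply: (@le_trans _ _ (\sum_x hit p (A :&: L)%SET l x * (H * m%:R))).
    apply: ler_sum => x _; rewrite ler_wpM2l ?hit_ge0// ler_wpM2l ?(ltW H_gt0)//.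
    by rewrite ler_nat geq_minr.
  by rewrite -mulr_suml ler_piMl ?mulr_ge0 ?hit_le1// ltW.
rewrite (bigID (fun x => x \in L :\: A))/=.
have h1 := hit_le1 subp (A :&: L)%SET l.
rewrite (bigID (fun x => x \in L :\: A))/= in h1.
have h2 := escape nA.
rewrite (eq_bigr (fun x =>
    hit p (A :&: L)%SET l x * (H * (#|L :\: A|%:R - 1)))) => [|x ->]; last first.
  by rewrite (minn_idPl _) ?natrB// (leq_trans _ (ltnW cm))// leq_subr.
rewrite [X in _ + X + _](eq_bigr (fun x =>
    hit p (A :&: L)%SET l x * (H * #|L :\: A|%:R))) => [|x /negPf ->]; last first.
  by rewrite subn0 (minn_idPl _)// ltnW.
rewrite -!mulr_suml /psi (minn_idPl _) ?(ltnW cm)//.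
move: h1 h2; set q := \sum_(i in _) _; set s := \sum_(i | _) _ => h1 h2.
have c1 : 1 <= #|L :\: A|%:R :> R by rewrite ler1n.
have q1 : q * (H * (#|L :\: A|%:R - 1)) <= (1 - s) * (H * (#|L :\: A|%:R - 1)).
  by rewrite ler_wpM2r ?mulr_ge0 ?subr_ge0 ?(ltW H_gt0)//; lra.
have q2 : s * H <= H - 1.
  by have := ler_wpM2r (ltW H_gt0) h2; rewrite mulrBl mul1r mulVf ?gt_eqF.
nra.
Qed.

End Filling.

Section RaceOfBranches.
Context {R : realType} {V : finType}.
Variables (p : V -> V -> R) (u l r : V) (L Q : {set V}) (M m : nat) (H : R).
Hypothesis subp : substochastic p.
Hypotheses (brL : branch p u l L) (brQ : branch p u r Q) (dLQ : ([disjoint L & Q])%B).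
Hypothesis p_lr : p u l = p u r.
Hypothesis M_gt0 : (0 < M)%N.
Hypotheses (card_L : (M <= #|L|)%N) (card_Q : (M <= #|Q|)%N).
Hypothesis H_gt0 : 0 < H.
Hypothesis escapeL : forall A : {set V}, ~~ (L \subset A) ->
  \sum_(x | x \notin (L :\: A)%SET) hit p (A :&: L)%SET l x <= 1 - H^-1.
Hypothesis escapeQ : forall A : {set V}, ~~ (Q \subset A) ->
  \sum_(x | x \notin (Q :\: A)%SET) hit p (A :&: Q)%SET r x <= 1 - H^-1.

Definition branch_race : {set V} * {set V} -> R :=
  race (fill_kernel p l L) (fill_kernel p r Q) (full L) (near L m) (full Q) (near Q m).

Definition race_at (A : {set V}) : R := branch_race (A :&: L, A :&: Q)%SET.

Let subL := fill_kernel_sub l L subp.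
Let subQ := fill_kernel_sub r Q subp.
Let subLQ := race_kernel_sub subL subQ.
Let near01 := @race_near01 R _ _ (near L m) (near Q m).

Lemma race_at_ge0 A : 0 <= race_at A.
Proof. exact: absorb_ge0. Qed.

Lemma race_at_set0 : race_at finset.set0 <= H * m%:R / Num.sqrt M%:R.
Proof.
rewrite /race_at !finset.set0I; apply: race_le => //.
- by apply: set0_nfull; exact: leq_trans card_L.
- by apply: set0_nfull; exact: leq_trans card_Q.
- by move=> n; exact: fill_arrival_early.
- by move=> n; exact: fill_arrival_early.
- by move=> N; apply: fill_near_mass => //; exact: leq_trans card_L.
- by move=> N; apply: fill_near_mass => //; exact: leq_trans card_Q.
Qed.

Lemma race_at_full (A : {set V}) : (L \subset A) || (Q \subset A) ->
  race_at A = ((#|L :\: A| < m) && (#|Q :\: A| < m))%N%:R.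
Proof.
move=> fA; rewrite /race_at /branch_race /race absorb_stop//.
  by rewrite /race_near/= /near !finset.setDIr !finset.setDv !finset.setU0.
by rewrite /race_stop/= /full !finset.subsetI !subxx !andbT.
Qed.

Let F (A : {set V}) (x : V) := branch_race ((x |: A) :&: L, A :&: Q)%SET.
Let G (A : {set V}) (x : V) := branch_race (A :&: L, (x |: A) :&: Q)%SET.

(** Extends [race_at] to a particle under way: inside a branch the current excursion is undecided,
    so the value is averaged over its outcome; outside the branches the next coin has not been
    tossed. *)
Definition race_walk (A : {set V}) (y : V) : R :=
  if y \in L then \sum_x hit p (A :&: L)%SET y x * F A x
  else if y \in Q then \sum_x hit p (A :&: Q)%SET y x * G A x
  else race_at A.

Let setU1I (x : V) (A B : {set V}) : x \notin B -> ((x |: A) :&: B = A :&: B)%SET.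
Proof.
move=> xB; apply/setP => y; rewrite !inE; case: eqP => [->|//].
by rewrite (negPf xB) !andbF.
Qed.

Let LQ y : y \in L -> y \notin Q.
Proof. by move=> yL; rewrite (disjointFr dLQ yL). Qed.

Lemma race_walk_out (A : {set V}) y : y \notin A -> race_walk A y = race_at (y |: A)%SET.
Proof.
move=> yA; rewrite /race_walk; case: ifPn => yL.
  rewrite hit_out ?inE ?(negPf yA)// /F /race_at [in RHS](@setU1I y A Q)//.
  exact: LQ.
case: ifPn => yQ; last by rewrite /race_at !setU1I.
by rewrite hit_out ?inE ?(negPf yA)// /G /race_at [in RHS](@setU1I y A L).
Qed.

Lemma race_walk_ge0 A y : 0 <= race_walk A y.
Proof.
rewrite /race_walk; do 2?case: ifP => _; last exact: race_at_ge0.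
  by apply: sumr_ge0 => x _; rewrite mulr_ge0 ?hit_ge0//; exact: absorb_ge0.
by apply: sumr_ge0 => x _; rewrite mulr_ge0 ?hit_ge0//; exact: absorb_ge0.
Qed.

Lemma race_at_step (A : {set V}) : ~~ (L \subset A) -> ~~ (Q \subset A) ->
  race_walk A l + race_walk A r = 2 * race_at A.
Proof.
move=> nL nQ; have [_ lL _ _] := brL; have [_ rQ _ _] := brQ.
rewrite /race_walk lL rQ; case: ifPn => [rL|_]; first by move: (LQ rL); rewrite rQ.
rewrite /race_at {1}/branch_race /race absorb_step//; last first.
  by rewrite /race_stop/= /full !finset.subsetI !subxx !andbT (negPf nL).
rewrite race_kernel_sum/= !fill_kernel_sum -!finset.setIA !finset.setIid.
rewrite mulrC divfK//; congr (_ + _); apply: eq_bigr => x _; congr (_ * _).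
  by rewrite /F; congr (branch_race (_, _)); apply/setP => y;
    rewrite !inE; case: (y \in L); rewrite ?andbT ?andbF.
by rewrite /G; congr (branch_race (_, _)); apply/setP => y;
  rewrite !inE; case: (y \in Q); rewrite ?andbT ?andbF.
Qed.

(** Inside a branch the mean value property comes from [hit_in]. Outside, [race_walk] is the
    constant [race_at A], except that [u] sees the two entrances; these are equally likely by
    [p_lr], and [race_at_step] says that their mean is again [race_at A]. *)
Lemma race_walk_superharmonic (A : {set V}) y : ~~ (L \subset A) -> ~~ (Q \subset A) ->
  y \in A -> \sum_z p y z * race_walk A z <= race_walk A y.
Proof.
move=> nL nQ yA; have [uL lL inL outL] := brL; have [uQ rQ inQ outQ] := brQ.
have wu : race_walk A u = race_at A by rewrite /race_walk (negPf uL) (negPf uQ).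
have [yL|yL] := boolP (y \in L).
  rewrite {2}/race_walk yL hit_in ?inE ?yA// le_eqVlt; apply/orP; left; apply/eqP.
  apply: eq_bigr => z _; have [->|/(inL _ _ yL) zL] := eqVneq (p y z) 0.
    by rewrite !mul0r.
  congr (_ * _); case: zL => [zL|->]; first by rewrite /race_walk zL.
  by rewrite wu hit_out ?inE ?(negPf uL) ?andbF// /F /race_at setU1I.
have [yQ|yQ] := boolP (y \in Q).
  rewrite {2}/race_walk (negPf yL) yQ hit_in ?inE ?yA// le_eqVlt; apply/orP; left; apply/eqP.
  apply: eq_bigr => z _; have [->|/(inQ _ _ yQ) zQ] := eqVneq (p y z) 0.
    by rewrite !mul0r.
  congr (_ * _); case: zQ => [zQ|->].
    by rewrite /race_walk zQ; case: ifP => // /LQ; rewrite zQ.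
  by rewrite wu hit_out ?inE ?(negPf uQ) ?andbF// /G /race_at setU1I.
have -> : race_walk A y = race_at A by rewrite /race_walk (negPf yL) (negPf yQ).
have lr : r != l by apply: contraL (LQ lL) => /eqP <-; rewrite rQ.
have walkE z : z \notin L -> z \notin Q -> race_walk A z = race_at A.
  by move=> zL zQ; rewrite /race_walk (negPf zL) (negPf zQ).
have [->{y yA yL yQ}|yu] := eqVneq y u; last first.
  rewrite (eq_bigr (fun z => p y z * race_at A)) => [|z _]; last first.
    have [->|pz] := eqVneq (p y z) 0; first by rewrite !mul0r.
    rewrite walkE//; apply/negP => zz.
      by have [yy _] := outL _ _ yL zz pz; rewrite yy eqxx in yu.
    by have [yy _] := outQ _ _ yQ zz pz; rewrite yy eqxx in yu.
  by rewrite -mulr_suml ler_piMl ?race_at_ge0// subp.2.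
have := ler_wpM2r (race_at_ge0 A) (subp.2 u); rewrite mul1r; apply: le_trans.
rewrite mulr_suml le_eqVlt; apply/orP; left; apply/eqP.
rewrite (bigD1 l)//= [in RHS](bigD1 l)//= (bigD1 r)//= [in RHS](bigD1 r)//= !addrA.
congr (_ + _).
  rewrite -p_lr -!mulrDr race_at_step//; ring.
apply: eq_bigr => z /andP[zl zr]; have [->|pz] := eqVneq (p u z) 0.
  by rewrite !mul0r.
rewrite walkE//; apply/negP => zz.
  by have [_ yy] := outL _ _ uL zz pz; rewrite yy eqxx in zl.
by have [_ yy] := outQ _ _ uQ zz pz; rewrite yy eqxx in zr.
Qed.

End RaceOfBranches.

(** * Random walks and their exits *)

Section RealProbability.
Context {R : realType} {d : measure_display} {Omega : measurableType d}.
Variable P : probability Omega R.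
Implicit Types A B : set Omega.

Definition pr A : R := fine (P A).

Lemma prE A : measurable A -> P A = (pr A)%:E.
Proof. by move=> mA; rewrite /pr fineK// fin_num_measure. Qed.

Lemma pr_ge0 A : 0 <= pr A.
Proof. by rewrite fine_ge0. Qed.

Lemma pr_le A B : measurable A -> measurable B -> A `<=` B -> pr A <= pr B.
Proof.
by move=> mA mB AB; rewrite -lee_fin -!prE//; apply: le_measure; rewrite ?inE.
Qed.

Lemma pr_setT : pr [set: Omega] = 1.
Proof. by rewrite /pr probability_setT. Qed.

Lemma pr_set0 : pr set0 = 0.
Proof. by rewrite /pr measure0. Qed.

Lemma pr_setU A B : measurable A -> measurable B -> A `&` B = set0 ->
  pr (A `|` B) = pr A + pr B.
Proof.
move=> mA mB AB; apply: EFin_inj; rewrite EFinD -!prE//; last exact: measurableU.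
by rewrite measureU.
Qed.

Lemma pr_setC A : measurable A -> pr (~` A) = 1 - pr A.
Proof.
move=> mA; have := pr_setU mA (measurableC mA) (setICr A).
by rewrite setUCr pr_setT => ->; rewrite addrAC subrr add0r.
Qed.

Lemma pr_setU_le A B : measurable A -> measurable B -> pr (A `|` B) <= pr A + pr B.
Proof.
move=> mA mB; have mBA : measurable (B `\` A) by exact: measurableD.
have -> : A `|` B = A `|` (B `\` A).
  apply/seteqP; split=> x /=; last by case=> [|[]]; [left|right].
  by have [Ax|nAx] := pselect (A x); [left|case=> // Bx; right].
rewrite pr_setU//; last by rewrite setIDA setIC -setIDA setDv setI0.
by rewrite lerD2l pr_le//; exact: subDsetl.
Qed.

Lemma pr_partition (F : finType) (Y : Omega -> F) (E : set Omega) :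
  (forall y, measurable (Y @^-1` [set y])) -> measurable E ->
  pr E = \sum_y pr (E `&` Y @^-1` [set y]).
Proof.
move=> mY mE; have mEY y : measurable (E `&` Y @^-1` [set y]) by exact: measurableI.
suff H (r : seq F) : uniq r -> measurable (E `&` Y @^-1` [set` r]) /\
    pr (E `&` Y @^-1` [set` r]) = \sum_(y <- r) pr (E `&` Y @^-1` [set y]).
  have [_ <-] := H (index_enum F) (index_enum_uniq F); congr (pr _).
  by apply/seteqP; split=> [x Ex|x []//]; split=> //=; rewrite mem_index_enum.
elim: r => [_|y r IH /= /andP[yr /IH[mr prr]]].
  have -> : [set` [::]] = set0 :> set F by apply/seteqP; split.
  by rewrite preimage_set0 setI0 pr_set0 big_nil; split.
have -> : E `&` Y @^-1` [set` y :: r] =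
    (E `&` Y @^-1` [set y]) `|` (E `&` Y @^-1` [set` r]).
  apply/seteqP; split=> x /=.
    by case=> Ex; rewrite inE => /orP[/eqP|]; [left|right].
  by case=> -[Ex]; rewrite inE => yy; split=> //; rewrite yy ?eqxx ?orbT.
split; first exact: measurableU.
rewrite big_cons -prr pr_setU//; apply/seteqP; split=> // x [] [_ /= yx] [_ /=].
by rewrite yx (negPf yr).
Qed.

Lemma pr_bigcup_le (I : Type) (r : seq I) (Q : pred I) (A : I -> set Omega) (B : set Omega) :
  (forall i, measurable (A i)) -> measurable B ->
  (forall om, B om -> exists2 i, List.In i r & Q i /\ A i om) ->
  pr B <= \sum_(i <- r | Q i) pr (A i).
Proof.
move=> mA; elim: r B => [|i r IH] B mB BA.
  rewrite big_nil (_ : B = set0) ?pr_set0//.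
  by apply/seteqP; split=> // om /BA[].
rewrite big_cons; case: ifPn => Qi.
  apply: (@le_trans _ _ (pr (A i) + pr (B `\` A i))).
    apply: le_trans (pr_setU_le (mA i) (measurableD mB (mA i))).
    apply: pr_le => //; first by apply: measurableU => //; exact: measurableD.
    by move=> om Bom; have [?|?] := pselect (A i om); [left|right].
  rewrite lerD2l; apply: IH; first exact: measurableD.
  by move=> om [/BA[k [->|kr] [Qk Ak]]] nA //; exists k.
by apply: IH => // om /BA[k [<-|kr] [Qk Ak]]; [rewrite Qk in Qi|exists k].
Qed.

Lemma pr_union_le (I : finType) (Q : pred I) (A : I -> set Omega) (B : set Omega) :
  (forall i, measurable (A i)) -> measurable B ->
  (forall om, B om -> exists i, Q i /\ A i om) ->
  pr B <= \sum_(i | Q i) pr (A i).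
Proof.
move=> mA mB BA; apply: pr_bigcup_le => // om /BA[i Ai]; exists i => //.
have : i \in index_enum I by rewrite mem_index_enum.
elim: (index_enum I) => //= k r IH; rewrite inE => /orP[/eqP ->|/IH]; first by left.
by right.
Qed.

Lemma pr_bigcup_cvg (A : nat -> set Omega) :
  (forall n, measurable (A n)) -> nondecreasing_seq A ->
  pr (A n) @[n --> \oo] --> pr (\bigcup_n A n).
Proof.
move=> mA ndA; apply: fine_cvg; rewrite -prE; last exact: bigcup_measurable.
by apply: nondecreasing_cvg_mu => //; exact: bigcup_measurable.
Qed.

End RealProbability.

Lemma srw_kernel_sub {R : realType} {V : finType} (e : rel V) : substochastic (srw_kernel R e).
Proof.
split=> [x y|x]; first by rewrite /srw_kernel; case: ifP => // _; rewrite invr_ge0.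
rewrite /srw_kernel -big_mkcond/= sumr_const.
have -> : #|[pred i | e x i]| = #|[set z | e x z]%SET| by rewrite cardsE.
rewrite -[_ *+ _]mulr_natr; have [->|n0] := eqVneq #|[set z | e x z]%SET| 0%N.
  by rewrite mulr0.
by rewrite mulVf// pnatr_eq0.
Qed.

Section MeasurableProcess.
Context {d : measure_display} {Omega : measurableType d} {V : finType}.
Variable X : nat -> Omega -> V.

(** Used for both positions of [x]: outside [D] it is the exit at time [T], inside [D] it describes
    a walk that has not left up to time [T]. *)
Definition path_event (D : {set V}) (T : nat) (x : V) : set Omega :=
  [set om | (forall s, (s < T)%N -> X s om \in D) /\ X T om = x].

Definition settles (D : {set V}) (w : nat -> V) (x : V) : Prop :=
  x \notin D /\ exists T, (forall s, (s < T)%N -> w s \in D) /\ w T = x.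

Definition settle_event (D : {set V}) (x : V) : set Omega :=
  [set om | settles D (X ^~ om) x].

Hypothesis mX : forall t x, measurable (X t @^-1` [set x]).

Lemma measurable_walk_in (D : {set V}) t : measurable [set om | X t om \in D].
Proof.
have -> : [set om | X t om \in D] = \bigcup_(x in [set` D]) X t @^-1` [set x].
  by apply/seteqP; split=> [om omD|om [x xD /= ->]//]; exists (X t om).
by apply: fin_bigcup_measurable => // x _; exact: mX.
Qed.

Lemma measurable_walk_forall (D : {set V}) T :
  measurable [set om | forall s, (s < T)%N -> X s om \in D].
Proof.
have -> : [set om | forall s, (s < T)%N -> X s om \in D] =
    \bigcap_(s in [set s | (s < T)%N]) [set om | X s om \in D].
  by apply/seteqP; split.
by apply: fin_bigcap_measurable => [|s _]; [exact: finite_II|exact: measurable_walk_in].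
Qed.

Lemma measurable_path_event D T x : measurable (path_event D T x).
Proof. by apply: measurableI; [exact: measurable_walk_forall|exact: mX]. Qed.

Lemma settle_eventE (D : {set V}) x : x \notin D ->
  settle_event D x = \bigcup_T path_event D T x.
Proof.
move=> xD; apply/seteqP; split=> om.
  by move=> [_ [T ?]]; exists T.
by move=> [T _ ?]; split=> //; exists T.
Qed.

Lemma measurable_settle_event D x : measurable (settle_event D x).
Proof.
have [xD|xD] := boolP (x \in D); last first.
  rewrite settle_eventE//; apply: bigcup_measurable => T _.
  exact: measurable_path_event.
rewrite (_ : settle_event D x = set0)//; apply/seteqP; split=> // om [].
by rewrite xD.
Qed.

End MeasurableProcess.

Section Walk.
Context {R : realType} {d : measure_display} {Omega : measurableType d}.
Context {P : probability Omega R} {V : finType} {e : rel V} {v : V}.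
Variable X : nat -> Omega -> V.
Hypothesis srwX : simple_random_walk P e v X.
Let p := srw_kernel R e.

Let mX t x : measurable (X t @^-1` [set x]).
Proof. by have [] := srwX. Qed.

Lemma pr_path_event0 D x : pr P (path_event X D 0 x) = (x == v)%:R.
Proof.
have -> : path_event X D 0 x = X 0 @^-1` [set x] by apply/seteqP; split=> // om [].
have [_ Pv _] := srwX; have prv : pr P (X 0 @^-1` [set v]) = 1 by rewrite /pr Pv.
have [->//|xv] := eqVneq x v; apply/eqP; rewrite eq_le pr_ge0 andbT.
apply: (@le_trans _ _ (1 - pr P (X 0 @^-1` [set v]))); last by rewrite prv subrr.
rewrite -pr_setC//; apply: pr_le => //; first exact: measurableC.
by move=> om /= ->; exact/eqP.
Qed.

(** [simple_random_walk] conditions on one complete past, whereas [path_event] is a disjoint union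
    of such pasts; the identity is summed over all of them. *)
Lemma pr_markov_step D T z x :
  pr P (path_event X D T z `&` X T.+1 @^-1` [set x]) = pr P (path_event X D T z) * p z x.
Proof.
pose Y om : {ffun 'I_T.+1 -> V} := [ffun s : 'I_T.+1 => X s om].
have YE f : Y @^-1` [set f] = [set om | forall s, (s <= T)%N -> X s om = f (inord s)].
  apply/seteqP; split=> om /=.
    by move=> <- s sT; rewrite ffunE inordK.
  move=> H; apply/ffunP => s; rewrite ffunE H ?inord_val//.
  by rewrite -ltnS ltn_ord.
have mY f : measurable (Y @^-1` [set f]).
  rewrite YE (_ : [set om | _] = \bigcap_(s in [set s | (s < T.+1)%N]) X s @^-1` [set f (inord s)]).
    by apply: fin_bigcap_measurable => [|s _]; [exact: finite_II|exact: mX].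
  by apply/seteqP; split.
have mE := measurable_path_event mX D T z.
rewrite (pr_partition P mY (measurableI _ _ mE (mX _ _))) (pr_partition P mY mE) mulr_suml.
apply: eq_bigr => f _.
have [[fD fz]|nf] := pselect ((forall s, (s < T)%N -> f (inord s) \in D) /\ f (inord T) = z).
  have sub : Y @^-1` [set f] `<=` path_event X D T z.
    move=> om; rewrite YE/= => H; split; first by move=> s sT; rewrite H ?fD// ltnW.
    by rewrite H.
  have -> : path_event X D T z `&` Y @^-1` [set f] = Y @^-1` [set f] by apply/setIidr.
  rewrite setIAC (setIidr sub) YE; have [_ _ mk] := srwX.
  have := mk T (fun s => f (inord s)) x; rewrite /pr fz => ->.
  rewrite -YE fineM//; first exact: fin_num_measure.
suff h : path_event X D T z `&` Y @^-1` [set f] = set0.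
  by rewrite setIAC h set0I pr_set0 mul0r.
apply/seteqP; split=> // om [[omD omz]]; rewrite YE => H; apply: nf; split.
  by move=> s sT; rewrite -H ?omD// ltnW.
by rewrite -H.
Qed.

Lemma pr_path_eventS D T x :
  pr P (path_event X D T.+1 x) = \sum_(z in D) pr P (path_event X D T z) * p z x.
Proof.
rewrite (pr_partition P (mX T) (measurable_path_event mX D T.+1 x)) [RHS]big_mkcond/=.
apply: eq_bigr => z _; case: ifPn => zD.
  rewrite -pr_markov_step; congr (pr P _); apply/seteqP; split=> om.
    by move=> [[H Xx] Xz]; split=> //; split=> // s sT; apply: H; exact: ltnW.
  move=> [[H Xz] Xx]; split=> //; split=> // s; rewrite ltnS leq_eqVlt.
  by move=> /orP[/eqP ->|/H//]; rewrite Xz.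
rewrite (_ : _ `&` _ = set0) ?pr_set0//; apply/seteqP; split=> // om [[H Xx] Xz].
by move: (H _ (ltnSn T)); rewrite Xz (negPf zD).
Qed.

(* Optional stopping for the walk stopped at its exit from [D]. *)
Lemma sum_path_event_le (D : {set V}) (g : V -> R) N : (forall x, 0 <= g x) ->
  (forall x, x \in D -> \sum_z p x z * g z <= g x) ->
  \sum_(T < N) \sum_(x | x \notin D) pr P (path_event X D T x) * g x <= g v.
Proof.
move=> g0 gD.
suff : \sum_(T < N) \sum_(x | x \notin D) pr P (path_event X D T x) * g x
    + \sum_x pr P (path_event X D N x) * g x <= g v.
  apply: le_trans; rewrite lerDl; apply: sumr_ge0 => x _.
  by rewrite mulr_ge0// pr_ge0.
elim: N => [|N IH].
  rewrite big_ord0 add0r (bigD1 v)//= big1 => [|x /negPf xv].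
    by rewrite pr_path_event0 eqxx mul1r addr0.
  by rewrite pr_path_event0 xv mul0r.
apply: le_trans IH; rewrite big_ord_recr/= -addrA lerD2l.
rewrite [in leRHS](bigID (fun x => x \notin D))/= lerD2l.
under eq_bigr do rewrite pr_path_eventS mulr_suml.
rewrite exchange_big/= [in leRHS](eq_bigl (fun x => x \in D)) => [|x]; last exact: negbK.
apply: ler_sum => x xD; under eq_bigr do rewrite -mulrA.
by rewrite -mulr_sumr ler_wpM2l ?pr_ge0// gD.
Qed.

Lemma sum_settle_event_le (D : {set V}) (g : V -> R) : (forall x, 0 <= g x) ->
  (forall x, x \in D -> \sum_z p x z * g z <= g x) ->
  \sum_x pr P (settle_event X D x) * g x <= g v.
Proof.
move=> g0 gD.
pose U N x := \bigcup_(T < N) path_event X D T x.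
have mU N x : measurable (U N x).
  by apply: bigcup_measurable => T _; exact: measurable_path_event.
rewrite (bigID (fun x => x \notin D))/= [X in _ + X]big1 ?addr0 => [|x xD]; last first.
  rewrite (_ : settle_event X D x = set0) ?pr_set0 ?mul0r//.
  by apply/seteqP; split=> // om [xD']; rewrite xD' in xD.
have cv : \sum_(x <- [seq x <- index_enum V | x \notin D]) pr P (U N x) * g x @[N --> \oo]
    --> \sum_(x <- [seq x <- index_enum V | x \notin D]) pr P (\bigcup_N U N x) * g x.
  apply: cvgr_sum => x; apply: cvgMl; apply: pr_bigcup_cvg => //.
  move=> N N' NN'; apply/subsetPset => om [T TN ?]; exists T => //.
  exact: leq_trans TN NN'.
rewrite big_filter in cv.
rewrite (eq_bigr (fun x => pr P (\bigcup_N U N x) * g x)); last first.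
  move=> x xD; rewrite settle_eventE//; congr (pr P _ * _).
  apply/seteqP; split=> om; first by move=> [T _ ?]; exists T.+1 => //; exists T => /=.
  by move=> [N _ [T _ ?]]; exists T.
apply: (cvgr_to_le cv); apply: nearW => N; rewrite big_filter.
apply: le_trans (sum_path_event_le N g0 gD); rewrite exchange_big/=.
apply: ler_sum => x _; rewrite -mulr_suml ler_wpM2r//.
apply: pr_union_le => // [T|om [T TN ?]]; first exact: measurable_path_event.
by exists (Ordinal TN).
Qed.

(** As [g] vanishes outside [D], its expectation over the walks still in [D] loses at most the
    factor [1 - lam] per step; [g <= B] turns this expectation into a survival probability. *)
Lemma survival_ge (D : {set V}) (g : V -> R) (lam B : R) N : lam <= 1 ->
  (forall x, g x <= B) -> (forall x, x \notin D -> g x = 0) ->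
  (forall x, x \in D -> (1 - lam) * g x <= \sum_z p x z * g z) ->
  (1 - lam) ^+ N * g v <= B * pr P [set om | forall s, (s < N.+1)%N -> X s om \in D].
Proof.
move=> lam1 gB gD0 gD.
have sumD T : \sum_x pr P (path_event X D T x) * g x
    = \sum_(x in D) pr P (path_event X D T x) * g x.
  rewrite (bigID (fun x => x \in D))/= [X in _ + X]big1 ?addr0// => x xD.
  by rewrite gD0 ?mulr0.
have h : (1 - lam) ^+ N * g v <= \sum_x pr P (path_event X D N x) * g x.
  elim: N => [|N IH].
    rewrite (bigD1 v)//= big1 => [|x /negPf xv].
      by rewrite pr_path_event0 eqxx expr0 addr0.
    by rewrite pr_path_event0 xv mul0r.
  rewrite exprS -mulrA; apply: le_trans (ler_wpM2l _ IH) _; first by lra.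
  under [leRHS]eq_bigr do rewrite pr_path_eventS mulr_suml.
  rewrite [leRHS]exchange_big/= sumD mulr_sumr; apply: ler_sum => x xD.
  under [leRHS]eq_bigr do rewrite -mulrA.
  by rewrite -mulr_sumr mulrCA ler_wpM2l ?pr_ge0// gD.
apply: le_trans h _; rewrite sumD.
rewrite (pr_partition P (mX N) (measurable_walk_forall mX D N.+1)) mulr_sumr big_mkcond/=.
apply: ler_sum => x _; case: ifPn => xD.
  rewrite mulrC (_ : _ `&` _ = path_event X D N x); first by rewrite ler_wpM2r ?pr_ge0.
  apply/seteqP; split=> om [H Xx]; split=> // s; first by move=> sN; apply: H; exact: ltnW.
  by rewrite ltnS leq_eqVlt => /orP[/eqP ->|/H//]; rewrite Xx.
rewrite (_ : _ `&` _ = set0) ?pr_set0 ?mulr0//; apply/seteqP; split=> // om [H Xx].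
by move: (H _ (ltnSn N)); rewrite Xx (negPf xD).
Qed.

End Walk.

(** * Settling histories *)

Section ProcessSigmaAlgebra.
Context {d : measure_display} {Omega : measurableType d} {V : finType}.
Variable X : nat -> Omega -> V.

Let basic : set (set Omega) := [set A | exists t x, A = X t @^-1` [set x]].

Let measurable_basic t x :
  @measurable _ (g_sigma_algebraType basic) (X t @^-1` [set x]).
Proof. by apply: sub_sigma_algebra; exists t, x. Qed.

(** The measurability lemma is applied to [Omega] equipped with the sigma-algebra generated by [X]
    in place of its own. *)
Lemma process_sigma_settle_event D x : process_sigma_algebra X (settle_event X D x).
Proof.
exact: (@measurable_settle_event _ (g_sigma_algebraType basic) V X measurable_basic D x).
Qed.

Lemma process_sigma_leaves (D : {set V}) N :
  process_sigma_algebra X (~` [set om | forall s, (s < N)%N -> X s om \in D]).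
Proof.
have := @measurable_walk_forall _ (g_sigma_algebraType basic) V X measurable_basic D N.
exact: measurableC.
Qed.

End ProcessSigmaAlgebra.

Lemma pr_bigcap_independent {R : realType} {d : measure_display}
    {Omega : measurableType d} {P : probability Omega R} {I V : finType}
    {X : I -> nat -> Omega -> V} (J : {set I}) (A : I -> set Omega) :
  independent_processes P X -> (forall i, measurable (A i)) ->
  (forall i, process_sigma_algebra (X i) (A i)) ->
  pr P (\bigcap_(i in [set` J]) A i) = \prod_(i in J) pr P (A i).
Proof.
move=> ind mA sA; rewrite /pr ind => [|i _]; last exact: sA.
rewrite (eq_bigr (fun i => (pr P (A i))%:E)) => [|i _]; last by rewrite prE.
by rewrite prodEFin.
Qed.

Section SettlingHistory.
Context {V : finType}.
Implicit Types (w : nat -> nat -> V) (s : seq V) (A : {set V}).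

Definition occupied_by s (k : nat) : {set V} := [set x in take k s]%SET.

Lemma occupied_by0 s : occupied_by s 0 = finset.set0.
Proof. by apply/setP => x; rewrite /occupied_by take0 !inE. Qed.

Lemma occupied_byS x0 s k : (k < size s)%N ->
  occupied_by s k.+1 = (nth x0 s k |: occupied_by s k)%SET.
Proof.
by move=> ks; apply/setP => x; rewrite /occupied_by (take_nth x0)// !inE mem_rcons inE.
Qed.

Lemma settling_time_some A (f : nat -> V) t : settling_time A f = Some t ->
  f t \notin A /\ (forall i, (i < t)%N -> f i \in A).
Proof.
rewrite /settling_time; case: pselect => // ex [<-]; case: ex_minnP => m mA mmin.
by split=> // i im; apply: contraT => /mmin; rewrite leqNgt im.
Qed.

(* The vertices where the particles of [w] settle, in order, with [v0] standing
   for a particle that never settles. *)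
Definition history (v0 : V) w (n : nat) : seq V :=
  mkseq (fun k => if settling_time (occupied w k) (w k) is Some t then w k t else v0) n.

Lemma occupied_history v0 w n : (forall k, (k < n)%N -> settling_time (occupied w k) (w k)) ->
  forall k, (k <= n)%N -> occupied w k = occupied_by (history v0 w n) k.
Proof.
move=> st; elim=> [|k IH] kn; first by rewrite occupied_by0.
rewrite (occupied_byS v0) ?size_mkseq// nth_mkseq// -IH ?(ltnW kn)//=.
by have := st k kn; case: settling_time.
Qed.

Lemma settles_history v0 w n : (forall k, (k < n)%N -> settling_time (occupied w k) (w k)) ->
  forall k, (k < n)%N ->
  settles (occupied_by (history v0 w n) k) (w k) (nth v0 (history v0 w n) k).
Proof.
move=> st k kn; rewrite -occupied_history// ?(ltnW kn)// nth_mkseq//.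
have := st k kn; case E : settling_time => [t|//] _.
by have [tA tmin] := settling_time_some E; split=> //; exists t.
Qed.

End SettlingHistory.

Lemma sum_tuple_cons {R : realType} {V : finType} l (F : seq V -> R) :
  \sum_(s : l.+1.-tuple V) F s = \sum_x \sum_(s : l.-tuple V) F (x :: s).
Proof.
rewrite pair_bigA/= (reindex (fun q : V * l.-tuple V => [tuple of q.1 :: q.2])).
  by apply: eq_bigr.
exists (fun s : l.+1.-tuple V => (thead s, [tuple of behead s])) => [[x s] _|s _].
  by congr (_, _); exact: val_inj.
by rewrite [RHS]tuple_eta; apply: val_inj.
Qed.

(* Sums over histories, for an aggregation process whose [k]-th particle
   settles at [x] with probability [nu k A x] when [A] is occupied. *)
Section HistoryWeight.
Context {R : realType} {V : finType}.
Variable nu : nat -> {set V} -> V -> R.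
Hypothesis nu_ge0 : forall k A x, 0 <= nu k A x.

Fixpoint weight (k : nat) (A : {set V}) (s : seq V) : R :=
  if s is x :: s' then nu k A x * weight k.+1 (x |: A)%SET s' else 1.

Fixpoint has_step (bad : rel {set V}) (A : {set V}) (s : seq V) : bool :=
  if s is x :: s' then bad A (x |: A)%SET || has_step bad (x |: A)%SET s' else false.

Variable n : nat.
Hypothesis nu_le1 : forall k A, (k < n)%N -> \sum_x nu k A x <= 1.

Lemma sum_weight_le1 l k A : (k + l <= n)%N -> \sum_(s : l.-tuple V) weight k A s <= 1.
Proof.
elim: l k A => [|l IH] k A kl.
  rewrite (bigD1 [tuple])//= big1 ?addr0// => s /negP; case.
  by apply/eqP/val_inj; case: s => -[].
have kn : (k < n)%N by apply: leq_trans kl; rewrite addnS ltnS leq_addr.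
rewrite sum_tuple_cons/=; apply: le_trans (nu_le1 A kn); apply: ler_sum => x _.
by rewrite -mulr_sumr ler_piMr// IH// addSnnS.
Qed.

(** The maximal inequality for a nonnegative supermartingale: a bad step brings [Phi] to at least 1.
    The supermartingale property is asked only on [good] sets, since from any other set no bad step
    can follow. *)
Lemma sum_weight_has_step (bad : rel {set V}) (good : pred {set V}) (Phi : {set V} -> R) :
  (forall A, 0 <= Phi A) ->
  (forall k A, (k < n)%N -> good A -> \sum_x nu k A x * Phi (x |: A)%SET <= Phi A) ->
  (forall A A', bad A A' -> 1 <= Phi A') ->
  (forall A s, ~~ good A -> has_step bad A s = false) ->
  forall l k A, (k + l <= n)%N ->
  \sum_(s : l.-tuple V) weight k A s * (has_step bad A s)%:R <= Phi A.
Proof.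
move=> Phi0 PhiK badPhi goodbad; elim=> [|l IH] k A kl.
  rewrite big1// => s _; suff -> : tval s = [::] by rewrite mulr0.
  by case: s => -[].
have kn : (k < n)%N by apply: leq_trans kl; rewrite addnS ltnS leq_addr.
have [gA|/goodbad ngA] := boolP (good A); last first.
  by rewrite big1// => s _; rewrite ngA mulr0.
rewrite (sum_tuple_cons l (fun s => weight k A s * (has_step bad A s)%:R)).
apply: le_trans (PhiK k A kn gA); apply: ler_sum => x _.
rewrite (eq_bigr (fun s : l.-tuple V => nu k A x * (weight k.+1 (x |: A)%SET s *
    (bad A (x |: A)%SET || has_step bad (x |: A)%SET s)%:R))) => [|s _]; last first.
  by rewrite /= mulrA.
rewrite -mulr_sumr ler_wpM2l//; have [/badPhi b|_] := boolP (bad A (x |: A)%SET).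
  apply: le_trans b; apply: (@le_trans _ _ (\sum_(s : l.-tuple V) weight k.+1 (x |: A)%SET s)).
    by apply: ler_sum => s _; rewrite mulr1.
  by rewrite sum_weight_le1// addSnnS.
by rewrite IH// addSnnS.
Qed.

Lemma weight_prod x0 (s : seq V) : weight 0 finset.set0 s =
  \prod_(k < size s) nu k (occupied_by s k) (nth x0 s k).
Proof.
suff H t k : weight k [set x in t]%SET s = \prod_(i < size s)
    nu (k + i)%N [set x in t ++ take i s]%SET (nth x0 s i).
  have -> : finset.set0 = [set x in [::]]%SET :> {set V} by apply/setP => x; rewrite !inE.
  by rewrite H; apply: eq_bigr.
elim: s t k => [|x s IH] t k /=; first by rewrite big_ord0.
rewrite big_ord_recl/= addn0 cats0; congr (_ * _).
have -> : (x |: [set y in t])%SET = [set y in rcons t x]%SET.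
  by apply/setP => y; rewrite !inE mem_rcons inE.
rewrite IH; apply: eq_bigr => i _; rewrite /bump/= add1n addSnnS.
by rewrite cat_rcons.
Qed.

Lemma has_step_occupied (bad : rel {set V}) (s : seq V) k : (k < size s)%N ->
  bad (occupied_by s k) (occupied_by s k.+1) -> has_step bad finset.set0 s.
Proof.
rewrite -(occupied_by0 s).
suff H t j : (j < size s)%N -> bad [set x in t ++ take j s]%SET [set x in t ++ take j.+1 s]%SET ->
    has_step bad [set x in t]%SET s.
  by move=> ks b; rewrite {1}/occupied_by take0; exact: (H [::] k).
elim: s t j {k} => [|x s IH] t j //=.
have -> : (x |: [set y in t])%SET = [set y in rcons t x]%SET.
  by apply/setP => y; rewrite !inE mem_rcons inE.
case: j => [|j] js; first by rewrite !take0 cats0 cats1 => ->.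
by rewrite  /= -!cat_rcons => /(IH (rcons t x) j js) ->; rewrite orbT.
Qed.

End HistoryWeight.

(** * The binary tree *)

Lemma prefix_rconsE (T : eqType) (s t : seq T) x :
  prefix s (rcons t x) = prefix s t || (s == rcons t x).
Proof.
elim: t s => [|y t IH] [|z s] //=; last by rewrite IH eqseq_cons andb_orr.
Qed.

Lemma prefix_rcons_l (T : eqType) (s t : seq T) x : prefix (rcons s x) t -> prefix s t.
Proof. by apply: prefix_trans; exact: prefix_rcons. Qed.

Fixpoint common_prefix (s t : seq bool) : nat :=
  match s, t with
  | x :: s', y :: t' => if x == y then (common_prefix s' t').+1 else 0
  | _, _ => 0
  end.

Lemma common_prefix_rcons s t x :
  common_prefix (rcons s x) t = (common_prefix s t + prefix (rcons s x) t)%N.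
Proof.
elim: s t => [|y s IH] [|z t] //=.
  by rewrite andbC /=; case: eqP; rewrite ?prefix0s //; case: t.
by case: eqP => //= _; rewrite IH addSn.
Qed.

Lemma common_prefix_prefix s t : prefix s t -> common_prefix s t = size s.
Proof. by elim: s t => [|x s IH] [|y t] //= /andP[-> /IH ->]. Qed.

Lemma common_prefix_prefixr s t : prefix t s -> common_prefix s t = size t.
Proof. by elim: s t => [|x s IH] [|y t] //=; rewrite eq_sym => /andP[-> /IH ->]. Qed.

Lemma common_prefix_size s t : (common_prefix s t <= size t)%N.
Proof. by elim: s t => [|x s IH] [|y t] //=; case: eqP => //= _; exact: IH. Qed.

Lemma prefix_child (s t : seq bool) : prefix s t -> s != t ->
  (prefix (rcons s false) t + prefix (rcons s true) t = 1)%N.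
Proof.
elim: s t => [|x s IH] [|y t] //=; first by case: y => _ _; case: t.
by rewrite eqseq_cons; case: eqP => //= _; exact: IH.
Qed.

Section BinaryTree.
Variable h : nat.
Local Notation V := (bintree_vertex h).
Local Notation edge := (@bintree_edge h).
Implicit Types y z : V.

Definition vertex (t : seq bool) : V := insub_bseq h t.

Lemma vertexK t : (size t <= h)%N -> vertex t = t :> seq bool.
Proof. by move=> th; rewrite /vertex /insub_bseq insubdK. Qed.

Lemma eq_vertex z t : (size t <= h)%N -> (z == vertex t) = (z == t :> seq bool).
Proof. by move=> th; rewrite -val_eqE /= vertexK. Qed.

Lemma size_parent y : (size (take (size y).-1 y) <= h)%N.
Proof. by have := size_bseq y; rewrite size_take; case: ifP; lia. Qed.

Definition neighbors y : seq V :=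
  (if (size y < h)%N then [:: vertex (rcons y false); vertex (rcons y true)] else [::])
  ++ (if (0 < size y)%N then [:: vertex (take (size y).-1 y)] else [::]).

Lemma rcons_take (s : seq bool) : (0 < size s)%N ->
  exists b, s = rcons (take (size s).-1 s) b.
Proof.
case/lastP: s => // s b _; exists b; rewrite size_rcons/=.
by rewrite -cats1 takel_cat// take_size cats1.
Qed.

Lemma edgeP y z :
  reflect (exists b, z = rcons y b :> seq bool \/ y = rcons z b :> seq bool) (edge y z).
Proof.
apply: (iffP existsP) => -[b].
  by move=> /orP[/eqP E|/eqP E]; exists b; [left|right].
by move=> [E|E]; exists b; apply/orP; [left|right]; apply/eqP.
Qed.

Lemma mem_neighbors y z : (z \in neighbors y) = edge y z.
Proof.
apply/idP/edgeP => [|[b [E|E]]].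
- rewrite mem_cat => /orP[]; case: ifP => // sy.
    rewrite !inE !eq_vertex ?size_rcons// => /orP[]/eqP E; [exists false|exists true];
    by left.
  rewrite inE eq_vertex ?size_parent// => /eqP E.
  by have [b Eb] := rcons_take sy; exists b; right; rewrite E.
- have yh : (size y < h)%N by rewrite -(size_rcons y b) -E size_bseq.
  rewrite mem_cat yh !inE !eq_vertex ?size_rcons//; apply/orP; left; apply/orP.
  by case: b {yh} E; [right|left]; apply/eqP.
- have Ez : take (size y).-1 y = z by rewrite E size_rcons/= -cats1 takel_cat// take_size.
  have sy : (0 < size y)%N by rewrite E size_rcons.
  by rewrite mem_cat sy inE eq_vertex Ez ?eqxx ?orbT ?size_bseq.
Qed.

Lemma uniq_neighbors y : uniq (neighbors y).
Proof.
rewrite /neighbors; case: ifP => sy; case: ifP => sy0 //=; rewrite ?inE ?orbF ?andbT.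
- have ne b : rcons y b != take (size y).-1 y.
    by apply/eqP => /(congr1 size); rewrite size_rcons size_take; case: ifP; lia.
  rewrite !eq_vertex ?size_rcons ?size_parent// !vertexK ?size_rcons//.
  by rewrite negb_or !ne eqseq_rcons andbF.
- by rewrite eq_vertex ?vertexK ?size_rcons// eqseq_rcons andbF.
Qed.

Lemma neighbor_sum (T : nmodType) (F : V -> T) y : \sum_(z | edge y z) F z =
  (if (size y < h)%N then F (vertex (rcons y false)) + F (vertex (rcons y true)) else 0)
  + (if (0 < size y)%N then F (vertex (take (size y).-1 y)) else 0).
Proof.
rewrite (eq_bigl (mem (neighbors y))) => [|z]; last by rewrite -mem_neighbors.
rewrite -big_uniq ?uniq_neighbors//= big_cat/=.
by case: ifP => _; case: ifP => _; rewrite /= ?big_cons ?big_nil ?addr0.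
Qed.

Lemma degreeE y : #|[set z | edge y z]%SET| =
  ((if size y < h then 2 else 0) + (if 0 < size y then 1 else 0))%N.
Proof.
rewrite -sum1_card (eq_bigl (edge y)) => [|z]; last by rewrite inE.
exact: (neighbor_sum (fun=> 1%N)).
Qed.

Context {R : realType}.
Local Notation p := (srw_kernel R edge).

Lemma srw_sumE (F : V -> R) y : (0 < h)%N -> \sum_z p y z * F z =
  F y + (\sum_(z | edge y z) (F z - F y)) / #|[set z | edge y z]%SET|%:R.
Proof.
move=> h0; have d0 : #|[set z | edge y z]%SET|%:R != 0 :> R.
  by rewrite pnatr_eq0 degreeE; case: (size y) => [|?]; rewrite ?h0//=; lia.
rewrite sumrB sumr_const (_ : #|_| = #|[set z | edge y z]%SET|); last by rewrite cardsE.
rewrite -[F y *+ _]mulr_natr mulrBl mulfK// addrC subrK mulr_suml [RHS]big_mkcond/=.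
by apply: eq_bigr => z _; rewrite /srw_kernel; case: ifP => _; rewrite ?mul0r// mulrC.
Qed.

(* The common prefix length with [x] is harmonic away from the root and [x]. *)
Lemma common_prefix_neighbors (x : V) y :
  \sum_(z | edge y z) ((common_prefix z x)%:R - (common_prefix y x)%:R : R) =
  (prefix y x && (y != x))%:R - ((0 < size y)%N && prefix y x)%:R.
Proof.
have yh := size_bseq y; have xh := size_bseq x.
rewrite neighbor_sum addrC [RHS]addrC; congr (_ + _).
  case: ifP => sy /=; last by rewrite oppr0.
  have -> : common_prefix y x = (common_prefix (take (size y).-1 y) x + prefix y x)%N.
    by have [b E] := rcons_take sy; rewrite {1}E common_prefix_rcons -E.
  by rewrite vertexK ?size_parent// natrD opprD addrA subrr sub0r.
case: ifP => sy.
  have d b : (common_prefix (vertex (rcons y b)) x)%:R - (common_prefix y x)%:R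
      = (prefix (rcons y b) x)%:R :> R.
    by rewrite vertexK ?size_rcons// common_prefix_rcons natrD addrC addKr.
  rewrite !d -natrD; congr (_%:R).
  have [pyx|npyx] := boolP (prefix y x).
    have [E|yx] := eqVneq y x; last by rewrite prefix_child.
    have np b : prefix (rcons y b) x = false.
      by apply/negP => /size_prefix; rewrite size_rcons E ltnn.
    by rewrite !np.
  have np b : prefix (rcons y b) x = false by apply: contraNF npyx; exact: prefix_rcons_l.
  by rewrite !np.
have [pyx|//] := boolP (prefix y x).
suff -> : y == x by [].
have sxy : size x = size y.
  by apply/eqP; rewrite eqn_leq (size_prefix pyx) andbT (leq_trans xh)// leqNgt sy.
by move: pyx; rewrite prefixE -sxy take_size eq_sym.
Qed.

End BinaryTree.

Section Subtree.
Variable h : nat.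
Context {R : realType}.
Local Notation V := (bintree_vertex h).
Local Notation edge := (@bintree_edge h).
Local Notation p := (srw_kernel R edge).
Implicit Types y z u : V.

Definition subtree (t : seq bool) : {set V} := [set y : V | prefix t y]%SET.

Lemma srw_kernel_edge y z : p y z != 0 -> edge y z.
Proof. by rewrite /srw_kernel; case: ifP => //; rewrite eqxx. Qed.

Lemma subtree_branch u b : (size u < h)%N ->
  branch p u (vertex h (rcons u b)) (subtree (rcons u b)).
Proof.
move=> uh; split.
- by rewrite inE; apply/negP => /size_prefix; rewrite size_rcons ltnn.
- by rewrite inE vertexK ?size_rcons// prefix_refl.
- move=> y z; rewrite !inE => yL /srw_kernel_edge /edgeP[c [E|E]].
    by left; rewrite E prefix_rconsE yL.
  move: yL; rewrite E prefix_rconsE => /orP[|]; first by left.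
  by rewrite eqseq_rcons => /andP[/eqP uz _]; right; exact: val_inj.
- move=> y z; rewrite !inE => yL zL /srw_kernel_edge /edgeP[c [E|E]]; last first.
    by move: yL; rewrite E prefix_rconsE zL.
  move: zL; rewrite E prefix_rconsE (negPf yL) => /eqP E'; split.
    by apply: val_inj => /=; have [] := rcons_inj E'.
  by apply: val_inj; rewrite /= vertexK ?size_rcons// E E'.
Qed.

Lemma subtree_disjoint (u : V) :
  ([disjoint subtree (rcons u false) & subtree (rcons u true)])%B.
Proof.
apply/pred0P => y; apply/negbTE; rewrite /= !inE; apply/negP => /andP[].
move=> /prefixP[s ->] /prefixP[s'] /eqP.
by rewrite -!cats1 -!catA !cat1s eqseq_cat// eqxx.
Qed.

Lemma srw_kernel_children u : (size u < h)%N ->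
  p u (vertex h (rcons u false)) = p u (vertex h (rcons u true)).
Proof.
move=> uh; have e b : edge u (vertex h (rcons u b)).
  by apply/edgeP; exists b; left; rewrite vertexK ?size_rcons.
by rewrite /srw_kernel !e.
Qed.

Lemma card_subtree_ge (t : seq bool) : (size t <= h)%N ->
  (2 ^ (h - size t) <= #|subtree t|)%N.
Proof.
move=> th; rewrite -card_bool -card_tuple -cardsT.
pose f (s : (h - size t).-tuple bool) : V := vertex h (t ++ s).
have fK s : f s = t ++ s :> seq bool.
  by rewrite vertexK// size_cat size_tuple subnKC.
rewrite -(card_imset _ (_ : injective f)).
  apply: subset_leq_card; apply/fintype.subsetP => y /imsetP[s _ ->].
  by rewrite inE fK prefix_prefix.
move=> s s' /(congr1 val); rewrite /= !fK => /eqP.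
by rewrite eqseq_cat// eqxx => /eqP E; exact: val_inj.
Qed.

(** Gambler's ruin on the path from [u] to a free vertex [x0] of the subtree: starting one step
    below [u], the walk reaches [x0] before [u] with probability one over the length of the path,
    which is at most [h]. Settling earlier at another free vertex of the subtree is a success as
    well. *)
Lemma subtree_escape (u : V) b (A : {set V}) : (size u < h)%N ->
  ~~ (subtree (rcons u b) \subset A) ->
  \sum_(x | x \notin (subtree (rcons u b) :\: A)%SET)
     hit p (A :&: subtree (rcons u b))%SET (vertex h (rcons u b)) x <= 1 - h%:R^-1.
Proof.
move=> uh; set L := subtree _; set l := vertex h _ => /fintype.subsetPn[x0 x0L x0A].
have [uL lL inL outL] := subtree_branch b uh; rewrite -/L -/l in uL lL inL outL.
have h0 : (0 < h)%N by apply: leq_ltn_trans uh.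
have prx : prefix (rcons u b) x0 by rewrite inE in x0L.
have sx : (size u < size x0)%N by have := size_prefix prx; rewrite size_rcons.
have K0 : 0 < (size x0)%:R - (size u)%:R :> R by rewrite subr_gt0 ltr_nat.
set K := _ - _ in K0.
pose c z : R := (common_prefix z x0)%:R - (size u)%:R.
pose g z : R := if z \in L then 1 - c z / K else 1.
have cu : c u = 0.
  by rewrite /c common_prefix_prefix ?subrr//; exact: prefix_rcons_l prx.
have gl : g l <= 1 - h%:R^-1.
  rewrite /g lL lerD2l lerN2 /c vertexK ?size_rcons// common_prefix_prefix// size_rcons.
  rewrite -natr1 addrAC subrr add0r mul1r lef_pV2 ?posrE ?ltr0n//.
  by rewrite /K lerBlDr -natrD ler_nat (leq_trans (size_bseq x0))// leq_addr.
apply: le_trans gl; rewrite big_mkcond/=.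
pose F z : R := (z \notin (L :\: A)%SET)%:R.
rewrite (eq_bigr (fun x => hit p (A :&: L)%SET l x * F x)) => [|x _]; last first.
  by rewrite /F; case: ifP => _; rewrite ?mulr1 ?mulr0.
have g0 z : 0 <= g z.
  rewrite /g; case: ifP => // _; rewrite subr_ge0 ler_pdivrMr// mul1r.
  by rewrite lerD2r ler_nat common_prefix_size.
apply: hit_le => //.
- exact: srw_kernel_sub.
- move=> x; rewrite /F finset.in_setD finset.in_setI !negb_and negbK => xD.
  have [xL|xL] := boolP (x \in L); last by rewrite /g (negPf xL) lern1 leq_b1.
  by move: xD; rewrite xL !orbF => /negPf ->; exact: g0.
- move=> y; rewrite finset.in_setI => /andP[yA yL].
  have -> : \sum_z p y z * g z = \sum_z p y z * (1 - c z / K).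
    apply: eq_bigr => z _; have [->|/(inL _ _ yL) zL] := eqVneq (p y z) 0.
      by rewrite !mul0r.
    congr (_ * _); case: zL => [zL|->]; first by rewrite /g zL.
    by rewrite /g (negPf uL) cu mul0r subr0.
  rewrite srw_sumE// /g yL gerDl.
  rewrite (eq_bigr (fun z =>
    - K^-1 * ((common_prefix z x0)%:R - (common_prefix y x0)%:R))); last first.
    by move=> z _; rewrite /c; ring.
  rewrite -mulr_sumr common_prefix_neighbors.
  have yx : y != x0 by apply: contraNneq x0A => <-.
  have sy : (0 < size y)%N.
    by move: yL; rewrite inE => /size_prefix; rewrite size_rcons; exact: leq_trans.
  by rewrite yx sy andbT subrr mulr0 mul0r.
Qed.

End Subtree.

(* [S d] is the expected time for a walk started at depth [d] to reach the root:
   crossing from depth [i + 1] to depth [i] takes [2 ^ (h + 1 - i) - 3] steps. *)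
Section Survival.
Variable h : nat.
Context {R : realType} {d : measure_display} {Omega : measurableType d}.
Context {P : probability Omega R}.
Local Notation V := (bintree_vertex h).
Local Notation edge := (@bintree_edge h).
Local Notation p := (srw_kernel R edge).
Variable X : nat -> Omega -> V.
Hypothesis srwX : simple_random_walk P edge (bintree_root h) X.

Let s (i : nat) : R := 2 ^+ (h.+1 - i) - 3.
Let S (n : nat) : R := \sum_(i < n) s i.

(** The test function [g] for [survival_ge] is [1 - c / size u], plus [lam * S (size y)] in the half
    of the tree away from [u]. In the half of [u], above the target subtree, it is harmonic. At the
    root the first term loses [1 / size u] towards [u], and [lam] is chosen so that [lam * s 0]
    towards the other child restores exactly this. In the other half the drift is [- lam], which is
    at least [- lam * g] because [g >= 1] there. The factor 5 bounds [g], as [lam * S] is at most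
    4. *)
Lemma subtree_survival (u : V) (lam : R) N : (1 < h)%N -> (0 < size u)%N ->
  lam = ((size u)%:R * (2 ^+ h.+1 - 3))^-1 ->
  (1 - lam) ^+ N <=
  5 * pr P [set om | forall t, (t < N.+1)%N -> X t om \in (~: subtree h u)%SET].
Proof.
move=> h1 u0 lamE.
have s0 i : (i < h)%N -> 1 <= s i.
  move=> ih; rewrite /s (_ : (h.+1 - i = 2 + (h - i - 1))%N); last by lia.
  rewrite exprD; have : 1 <= 2 ^+ (h - i - 1) :> R by rewrite exprn_ege1// ler1n.
  by rewrite expr2; lra.
have SS n : S n.+1 = S n + s n by rewrite /S big_ord_recr.
have S0 n : (n <= h)%N -> 0 <= S n.
  elim: n => [|n IH] nh; first by rewrite /S big_ord0.
  by rewrite SS addr_ge0 ?IH ?(ltnW nh)// (le_trans _ (s0 _ nh)).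
have SM n : (n <= h)%N -> S n <= 2 ^+ h.+2 - 2 ^+ (h.+2 - n).
  elim: n => [|n IH] nh; first by rewrite /S big_ord0 subn0 subrr.
  rewrite SS; have {IH} := IH (ltnW nh).
  rewrite /s (_ : (h.+2 - n = (h.+1 - n).+1)%N); last by lia.
  by rewrite subSS (exprS _ (h.+1 - n)); lra.
have pos : 0 < 2 ^+ h.+1 - 3 :> R by have := s0 0%N (ltnW h1); rewrite /s subn0; lra.
have j1 : 1 <= (size u)%:R :> R by rewrite ler1n.
have lam0 : 0 < lam by rewrite lamE invr_gt0 mulr_gt0// (lt_le_trans _ j1).
have lamS n : (n <= h)%N -> lam * S n <= 4.
  move=> nh; rewrite lamE mulrC ler_pdivrMr ?mulr_gt0// ?(lt_le_trans _ j1)//.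
  apply: le_trans (SM n nh) _; have : 0 <= 2 ^+ (h.+2 - n) :> R by rewrite exprn_ge0.
  have p4 : 4 <= 2 ^+ h :> R.
    have : 1 <= 2 ^+ (h - 2) :> R by rewrite exprn_ege1// ler1n.
    by rewrite -{2}(subnKC h1) exprD expr2; lra.
  rewrite !exprS; set q := 2 ^+ h in p4 *; set j := _%:R in j1 *; nra.
have lam1 : lam <= 1.
  rewrite lamE invf_le1 ?mulr_gt0// ?(lt_le_trans _ j1)//.
  by have := s0 0%N (ltnW h1); rewrite /s subn0; nra.
pose c (y : V) := common_prefix y u.
pose w (y : V) : R := if c y == 0%N then lam * S (size y) else 0.
pose g (y : V) : R := 1 - (c y)%:R / (size u)%:R + w y.
have gr : g (bintree_root h) = 1.
  by rewrite /g /w /c /= /S big_ord0 mulr0 mul0r subr0 addr0.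
have -> : (1 - lam) ^+ N = (1 - lam) ^+ N * g (bintree_root h) by rewrite gr mulr1.
have yh (y : V) : (size y <= h)%N by exact: size_bseq.
have w0 y : 0 <= w y by rewrite /w; case: ifP => // _; rewrite mulr_ge0 ?(ltW lam0)// S0.
have cj y : (c y)%:R / (size u)%:R <= 1 :> R.
  by rewrite ler_pdivrMr ?mul1r ?ler_nat ?common_prefix_size// (lt_le_trans _ j1).
apply: (@survival_ge _ _ _ P V edge (bintree_root h) X srwX _ g) => //.
- move=> y; rewrite /g; have : 0 <= (c y)%:R / (size u)%:R :> R by rewrite divr_ge0.
  have : w y <= 4 by rewrite /w; case: ifP => // _; apply: lamS.
  by lra.
- move=> y; rewrite !inE negbK => uy.
  have cu : c y = size u by exact: common_prefix_prefixr.
  rewrite /g /w cu divff ?subrr ?add0r; last by rewrite gt_eqF// (lt_le_trans _ j1).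
  by rewrite eqn0Ngt u0.
move=> y; rewrite !inE => uy.
rewrite srw_sumE; last exact: ltnW.
rewrite mulrBl mul1r lerD2l.
have g0 : 0 <= g y by rewrite /g addr_ge0// subr_ge0.
have yu : y != u by apply: contraNneq uy => ->; exact: prefix_refl.
have -> : \sum_(z | edge y z) (g z - g y) =
    - (size u)%:R^-1 * ((prefix y u)%:R - ((0 < size y)%N && prefix y u)%:R)
    + \sum_(z | edge y z) (w z - w y).
  have := @common_prefix_neighbors h R u y; rewrite yu andbT => <-.
  rewrite mulr_sumr -big_split/=; apply: eq_bigr => z _.
  by rewrite /g /c; ring.
have lamg : - (lam * g y) <= 0 by rewrite oppr_le0 mulr_ge0// ltW.
have [c0|c0] := eqVneq (c y) 0%N; last first.
  have sy : (0 < size y)%N by rewrite lt0n; apply: contraNneq c0 => /size0nil E; rewrite /c E.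
  rewrite sy subrr mulr0 add0r big1 ?mul0r// => z yz.
  have wy : w y = 0 by rewrite /w (negPf c0).
  rewrite wy subr0 /w; case: eqP => // cz.
  move/edgeP: yz => [b [E|E]].
    by move: cz c0; rewrite /c E common_prefix_rcons => /eqP; rewrite addn_eq0 => /andP[->].
  move: c0; rewrite /c E common_prefix_rcons -/(c z) cz add0n eqb0 negbK => pr.
  by rewrite -(common_prefix_prefix (prefix_rcons_l pr)) -/(c z) cz /S big_ord0 mulr0.
have [sy|sy] := posnP (size y).
  have E : y = [::] :> seq bool by exact: size0nil.
  rewrite [in prefix _ _]E prefix0s /= subr0 mulr1.
  rewrite neighbor_sum sy (ltnW h1) /= addr0.
  have wy : w y = 0 by rewrite /w c0 eqxx sy /S big_ord0 mulr0.
  have wc b : w (vertex h (rcons y b)) = (1 - (prefix (rcons y b) u)%:R) / (size u)%:R.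
    rewrite /w /c vertexK ?size_rcons ?sy ?(ltnW h1)// common_prefix_rcons -/(c y) c0 add0n eqb0.
    case: (prefix _ _); rewrite /= ?subrr ?mul0r// subr0 mul1r.
    rewrite /S big_ord1 /s subn0 lamE invfM -mulrA mulVf ?mulr1//.
    by rewrite gt_eqF.
  have pc := @prefix_child y u; rewrite {1}E prefix0s in pc.
  have {pc} := pc isT yu => /(congr1 (fun n => n%:R : R)); rewrite natrD => pc.
  rewrite !wc wy !subr0 -mulrDl.
  suff -> : 1 - (prefix (rcons y false) u)%:R + (1 - (prefix (rcons y true) u)%:R) = 1 :> R.
    by rewrite mul1r addNr mul0r.
  by lra.
have npy : prefix y u = false.
  by apply/negP => /common_prefix_prefix E; rewrite -E -/(c y) c0 in sy.
rewrite npy andbF subrr mulr0 add0r.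
have wy : w y = lam * S (size y) by rewrite /w c0.
have g1 : 1 <= g y.
  by rewrite /g c0 mul0r subr0 lerDl.
rewrite degreeE neighbor_sum sy.
have wp : w (vertex h (take (size y).-1 y)) = lam * S (size y).-1.
  have [b E] := rcons_take sy.
  have : c y = common_prefix (rcons (take (size y).-1 y) b) u by rewrite -E.
  rewrite c0 common_prefix_rcons => /esym /eqP; rewrite addn_eq0 => /andP[/eqP cp _].
  rewrite /w /c vertexK ?size_parent// cp eqxx size_take.
  by case: ltnP => //; rewrite leqNgt prednK// leqnn.
have sn : exists n, size y = n.+1 by exists (size y).-1; rewrite prednK.
have [n yn] := sn; rewrite wp wy yn /= SS.
case: ifPn => nh.
  have wc b : w (vertex h (rcons y b)) = lam * S n.+2.
    rewrite /w /c vertexK ?size_rcons ?yn// common_prefix_rcons -/(c y) c0 add0n eqb0.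
    suff -> : prefix (rcons y b) u = false by [].
    by apply: contraFF npy; exact: prefix_rcons_l.
  rewrite !wc !SS.
  (* At depth [n + 1] the two children add [lam * s n.+1] each and the parent takes away
     [lam * s n]; by this recursion the mean increment is exactly [- lam]. *)
  have -> : s n = 2 * s n.+1 + 3.
    by rewrite /s -(@subnSK n h.+1) ?exprS; [lra|exact: ltnW (ltnW nh)].
  rewrite addn1; set a := s n.+1; set q := S n.
  rewrite (_ : _ / 3%:R = - lam); last by field.
  by rewrite lerN2 ler_peMr// ltW.
have hn : h = n.+1 by apply/eqP; rewrite eqn_leq leqNgt nh -yn yh.
(* A leaf has only its parent as neighbor, so the last crossing takes one step and the drift is
   again [- lam]. *)
have -> : s n = 1.
  by rewrite /s hn -(addn2 n) addKn expr2; lra.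
rewrite !add0n add0r divr1 (_ : _ - _ = - lam); last by ring.
by rewrite lerN2 ler_peMr// ltW.
Qed.

End Survival.

(** * Aggregation on a graph *)

Section AggregationHistories.
Context {R : realType} {d : measure_display} {Omega : measurableType d}.
Context {P : probability Omega R} {V : finType}.
Variables (e : rel V) (v : V) (X : nat -> nat -> Omega -> V).
Hypothesis idlaX : idla_walks P e v X.
Local Notation n := #|V|.

Let mX k t x : (k < n)%N -> measurable (X k t @^-1` [set x]).
Proof. by move=> kn; have [/(_ k kn)[mk _ _] _] := idlaX. Qed.

Definition settle_prob (k : nat) (A : {set V}) (x : V) : R := pr P (settle_event (X k) A x).

Definition history_event (s : seq V) : set Omega :=
  \bigcap_(k in [set` [set: 'I_n]%SET]) settle_event (X k) (occupied_by s k) (nth v s k).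

Lemma settle_prob_le (k : nat) (A : {set V}) (g : V -> R) : (k < n)%N -> (forall x, 0 <= g x) ->
  (forall x, x \in A -> \sum_z srw_kernel R e x z * g z <= g x) ->
  \sum_x settle_prob k A x * g x <= g v.
Proof. by move=> kn; have [/(_ k kn) srwk _] := idlaX; exact: sum_settle_event_le. Qed.

Lemma sum_settle_prob_le1 k A : (k < n)%N -> \sum_x settle_prob k A x <= 1.
Proof.
move=> kn; have := @settle_prob_le k A (fun=> 1) kn.
under eq_bigr do rewrite mulr1; apply => // x _.
by under eq_bigr do rewrite mulr1; exact: (srw_kernel_sub e).2.
Qed.

Lemma settle_prob_occupied k (A : {set V}) x : x \in A -> settle_prob k A x = 0.
Proof.
move=> xA; rewrite /settle_prob (_ : settle_event _ _ _ = set0) ?pr_set0//.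
by apply/seteqP; split=> // om [xA']; rewrite xA in xA'.
Qed.

(** The indicator of [x] is superharmonic on [A], as no vertex of [A] leads to [x], and it vanishes
    at the starting point [v]. *)
Lemma settle_prob_disconnected k (A : {set V}) x : (k < n)%N -> x != v ->
  (forall y, y \in A -> ~~ e y x) -> settle_prob k A x = 0.
Proof.
move=> kn xv Ax; apply/eqP; rewrite eq_le pr_ge0 andbT.
have := @settle_prob_le k A (fun z => (z == x)%:R) kn.
rewrite eq_sym (negPf xv) (bigD1 x)//= eqxx mulr1 => H.
apply: le_trans (H _ _) => [||y yA].
  by rewrite lerDl sumr_ge0// => z _; rewrite mulr_ge0 ?pr_ge0.
  by move=> z.
rewrite big1// => z _; have [->|_] := eqVneq z x; last by rewrite mulr0.
by rewrite /srw_kernel (negPf (Ax y yA)) mul0r.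
Qed.

Lemma measurable_settle (k : 'I_n) A x : measurable (settle_event (X k) A x).
Proof. by apply: measurable_settle_event => t y; exact: mX. Qed.

Lemma measurable_history_event s : measurable (history_event s).
Proof. by apply: fin_bigcap_measurable => // k _; exact: measurable_settle. Qed.

(** Once the history is fixed, the occupied sets are deterministic and the settling events concern
    different independent walks, so the probability factorizes. *)
Lemma pr_history_event s : size s = n ->
  pr P (history_event s) = weight settle_prob 0 finset.set0 s.
Proof.
move=> sn; have [_ indX] := idlaX.
rewrite /history_event (pr_bigcap_independent _ indX).
- rewrite (weight_prod _ v) sn; apply: eq_bigl => k; by rewrite finset.in_setT.
- by move=> k; exact: measurable_settle.
- by move=> k; exact: process_sigma_settle_event.
Qed.

(** This holds for all histories of positive probability. In the tree it guarantees that a vertex is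
    occupied before its descendants. *)
Definition connected_history (s : seq V) : bool :=
  [forall k : 'I_n, (nth v s k == v) || [exists y in occupied_by s k, e y (nth v s k)]].

Lemma pr_disconnected_history s : size s = n -> ~~ connected_history s ->
  pr P (history_event s) = 0.
Proof.
move=> sn; rewrite negb_forall => /existsP[k]; rewrite negb_or => /andP[kv].
rewrite negb_exists => /forallP ks.
rewrite pr_history_event// (weight_prod _ v) sn (bigD1 k)//= settle_prob_disconnected ?mul0r//.
by move=> y yA; have := ks y; rewrite yA.
Qed.

Lemma sum_history_has_step (bad : rel {set V}) (good : pred {set V}) (Phi : {set V} -> R) :
  (forall A, 0 <= Phi A) ->
  (forall k A, (k < n)%N -> good A -> \sum_x settle_prob k A x * Phi (x |: A)%SET <= Phi A) ->
  (forall A A', bad A A' -> 1 <= Phi A') ->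
  (forall A s, ~~ good A -> has_step bad A s = false) ->
  \sum_(s : n.-tuple V | has_step bad finset.set0 s) pr P (history_event s)
    <= Phi finset.set0.
Proof.
move=> Phi0 PhiK badPhi goodbad; rewrite big_mkcond/=.
have := @sum_weight_has_step _ _ _ (fun k A x => pr_ge0 P _) n sum_settle_prob_le1
  bad good Phi Phi0 PhiK badPhi goodbad n 0 finset.set0 (leqnn _).
apply: le_trans; apply: ler_sum => s _; case: ifP => hs; last by rewrite mulr0.
by rewrite mulr1 pr_history_event ?size_tuple.
Qed.

Definition quick_event (c : R) (k : nat) (D : {set V}) (x : V) : set Omega :=
  \bigcup_(t in [set t | t%:R < c]) path_event (X k) D t x.

Definition new_vertices (s : seq V) : bool :=
  [forall k : 'I_n, nth v s k \notin occupied_by s k].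

(** Writing the event as a finite union over histories gives its measurability and allows each
    history to be treated as fixed. Positivity of [c] matches the initial value 0 of the maximum. *)
Lemma dispersion_lt (c : R) : 0 < c ->
  ~` [set om | (c%:E <= dispersion_time R (fun k t => X k t om))%E] =
  \bigcup_(s in [set s : n.-tuple V | new_vertices s])
    \bigcap_(k in [set: 'I_n]) quick_event c k (occupied_by s k) (nth v s k).
Proof.
move=> c0; apply/seteqP; split=> om /=.
  move=> /negP; rewrite -ltNge /dispersion_time => /bigmax_ltP[_ H].
  pose w k t := X k t om.
  have {}H k : (k < n)%N -> exists2 t, settling_time (occupied w k) (w k) = Some t & t%:R < c.
    move=> kn; have := H (Ordinal kn) isT; rewrite /particle_steps/=.
    rewrite -/(w) -/(w k).
    by case: settling_time => // t; rewrite lte_fin => tc; exists t.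
  have st k : (k < n)%N -> settling_time (occupied w k) (w k) by move=> /H[t ->].
  have ss := settles_history v st.
  have sz : size (history v w n) == n by rewrite size_mkseq.
  exists (Tuple sz) => /=.
    by apply/forallP => k; have [] := ss k (ltn_ord k).
  move=> k _; have [t tE tc] := H k (ltn_ord k); exists t => //=.
  have [_ tA] := settling_time_some tE.
  rewrite -(occupied_history v st) ?(ltnW (ltn_ord k))// nth_mkseq// tE.
  by split.
move=> [s /= /forallP ns qs]; apply/negP; rewrite -ltNge /dispersion_time.
pose w k t := X k t om.
have st k : (k < n)%N -> occupied w k = occupied_by s k ->
    exists2 t, settling_time (occupied w k) (w k) = Some t & t%:R < c /\ w k t = nth v s k.
  move=> kn ->; have [t tc [tA tx]] := qs (Ordinal kn) I.
  exists t => //; rewrite /settling_time; case: pselect => [ex|]; last first.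
    by case; exists t; rewrite /w tx; exact: (ns (Ordinal kn)).
  congr Some; case: ex_minnP => m mA mmin; apply/eqP; rewrite eqn_leq mmin ?andbT.
    by rewrite leqNgt; apply: contra mA => /tA.
  by rewrite /w tx; exact: (ns (Ordinal kn)).
have occ k : (k <= n)%N -> occupied w k = occupied_by s k.
  elim: k => [|k IH] kn; first by rewrite occupied_by0.
  have [t tE [_ tx]] := st k kn (IH (ltnW kn)).
  by rewrite (occupied_byS v) ?size_tuple//= tE tx IH// ltnW.
apply/bigmax_ltP; split=> // k _; have [t tE [tc _]] := st k (ltn_ord k) (occ k (ltnW (ltn_ord k))).
by rewrite /particle_steps -/w -/(w k) tE lte_fin.
Qed.

Lemma measurable_dispersion (c : R) : 0 < c ->
  measurable [set om | (c%:E <= dispersion_time R (fun k t => X k t om))%E].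
Proof.
move=> c0; rewrite -[X in measurable X]setCK; apply: measurableC.
rewrite dispersion_lt//; apply: fin_bigcup_measurable => // s _.
apply: fin_bigcap_measurable => // k _; apply: bigcup_measurable => t _.
by apply: measurable_path_event => i x; exact: mX.
Qed.

Lemma quick_settle_event (c : R) k (D : {set V}) x : x \notin D ->
  quick_event c k D x `<=` settle_event (X k) D x.
Proof. by move=> xD om [t _ ?]; split=> //; exists t. Qed.

End AggregationHistories.

(** * The last particles *)

Section LastParticles.
Variable h : nat.
Local Notation V := (bintree_vertex h).
Local Notation edge := (@bintree_edge h).
Local Notation n := #|V|.
Variable m : nat.

Definition full_side (u : seq bool) (A : {set V}) : bool :=
  (subtree h (rcons u false) \subset A) || (subtree h (rcons u true) \subset A).

(** The race below [u] ends at this very step, with both sides near; a full side stays full, so a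
    history contains at most one such step for each [u]. *)
Definition bad_step (u : seq bool) : rel {set V} := fun A A' =>
  [&& ~~ full_side u A, full_side u A',
      (#|subtree h (rcons u false) :\: A'| < m)%N &
      (#|subtree h (rcons u true) :\: A'| < m)%N].

Lemma full_side_mono u (A B : {set V}) : A \subset B -> full_side u A -> full_side u B.
Proof.
by move=> AB /orP[] H; apply/orP; [left|right]; exact: fintype.subset_trans AB.
Qed.

Lemma has_step_full u A s : full_side u A -> has_step (bad_step u) A s = false.
Proof.
elim: s A => //= x s IH A fA; rewrite /bad_step fA/= IH//.
by apply: full_side_mono fA; exact: finset.subsetUr.
Qed.

Lemma occupied_by_sub (s : seq V) i k : (i <= k)%N -> occupied_by s i \subset occupied_by s k.
Proof.
move=> ik; apply/fintype.subsetP => x; rewrite !inE => xi.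
by rewrite -(subnK ik) addnC takeD mem_cat xi.
Qed.

Lemma new_vertices_notin (s : n.-tuple V) v i k : new_vertices v s -> (i <= k)%N -> (k < n)%N ->
  nth v s k \notin occupied_by s i.
Proof.
move=> /forallP ns ik kn; apply: contra (ns (Ordinal kn)) => /=.
exact: (fintype.subsetP (occupied_by_sub s ik)).
Qed.

Lemma card_occupied_by (s : n.-tuple V) v k : new_vertices v s -> (k <= n)%N ->
  #|occupied_by s k| = k.
Proof.
move=> ns; elim: k => [|k IH] kn; first by rewrite occupied_by0 cards0.
rewrite (occupied_byS v) ?size_tuple// cardsU1 IH ?(ltnW kn)//.
by rewrite (new_vertices_notin ns (leqnn k))// add1n.
Qed.

Lemma occupied_by_all (s : n.-tuple V) v : new_vertices v s -> occupied_by s n = [set: V]%SET.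
Proof.
move=> ns; apply/eqP; rewrite eqEcard finset.subsetT/= cardsT.
by rewrite (card_occupied_by ns).
Qed.

(** The occupied set grows along edges from the root, and a strict descendant of [u] can be joined
    to it only through [u] or another strict descendant. *)
Lemma connected_parent (s : n.-tuple V) (u : V) b k z :
  connected_history edge (bintree_root h) s -> (k <= n)%N ->
  z \in occupied_by s k -> prefix (rcons u b) z -> u \in occupied_by s k.
Proof.
move=> /forallP cs; elim: k z => [|k IH] z kn; first by rewrite occupied_by0 inE.
have ->: occupied_by s k.+1 = (nth (bintree_root h) s k |: occupied_by s k)%SET.
  by rewrite (occupied_byS (bintree_root h)) ?size_tuple.
rewrite !in_setU1 => /orP[/eqP ->|zk] pz; last by rewrite (IH z) ?orbT// ltnW.
have := cs (Ordinal kn) => /= /orP[/eqP E|].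
  by move: pz; rewrite E; case: (tval _); case: (bseqval u).
move=> /existsP[y /andP[yk /edgeP[c [E|E]]]].
  move: pz; rewrite E prefix_rconsE => /orP[py|].
    by rewrite (IH y) ?orbT// ltnW.
  rewrite eqseq_rcons => /andP[/eqP uy _]; rewrite (_ : u = y) ?yk ?orbT//.
  exact: val_inj.
by rewrite (IH y) ?orbT ?(ltnW kn)// E prefix_rconsE pz.
Qed.

(** Descent by one level: if neither side of [u] were full when [m] vertices remain, the first side
    to fill later would do so with fewer than [m] free vertices in all, a bad step. So one side is
    full by then, [u] itself is occupied, and the remaining particles settle below the other
    child. *)
Lemma last_in_subtree (s : n.-tuple V) j :
  new_vertices (bintree_root h) s -> connected_history edge (bintree_root h) s ->
  (m <= n)%N -> (j <= h)%N ->
  (forall u : V, (size u < j)%N -> ~~ has_step (bad_step u) finset.set0 s) ->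
  exists2 u : V, size u = j &
    forall k, (n - m <= k)%N -> (k < n)%N -> nth (bintree_root h) s k \in subtree h u.
Proof.
move=> ns cs mn; elim: j => [|j IH] jh nbad.
  by exists (bintree_root h) => // k _ _; rewrite inE prefix0s.
have [|u uj Hu] := IH (ltnW jh); first by move=> u uj; apply: nbad; exact: ltnW.
have uh : (size u < h)%N by rewrite uj.
have fA : full_side u (occupied_by s (n - m)).
  apply: contraT => nfA.
  have ex : exists k, full_side u (occupied_by s k).
    by exists n; rewrite (occupied_by_all ns) /full_side finset.subsetT.
  case: (ex_minnP ex) => k fk kmin.
  have kn : (k <= n)%N by apply: kmin; rewrite (occupied_by_all ns) /full_side finset.subsetT.
  have mk : (n - m < k)%N.
    rewrite ltnNge; apply: contra nfA => km; apply: full_side_mono fk.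
    exact: occupied_by_sub.
  case: k fk kmin kn mk => // k fk kmin kn mk.
  have nfk : ~~ full_side u (occupied_by s k) by apply/negP => /kmin; rewrite ltnn.
  have small (L : {set V}) : (#|L :\: occupied_by s k.+1| < m)%N.
    apply: (@leq_ltn_trans #|~: occupied_by s k.+1|).
      by rewrite subset_leq_card// finset.setDE finset.subsetIr.
    have := cardsC (occupied_by s k.+1); rewrite (card_occupied_by ns)//.
    lia.
  have := nbad u; rewrite uj ltnSn => /(_ isT) /negP[].
  apply: (has_step_occupied (k := k)); first by rewrite size_tuple.
  by rewrite /bad_step nfk fk !small.
have [b fb] : exists b, subtree h (rcons u b) \subset occupied_by s (n - m).
  by case/orP: fA; [exists false|exists true].
have uo : u \in occupied_by s (n - m).
  apply: (@connected_parent s u b _ (vertex h (rcons u b)) cs); first exact: leq_subr.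
    by apply: (fintype.subsetP fb); rewrite inE vertexK ?size_rcons// prefix_refl.
  by rewrite vertexK ?size_rcons// prefix_refl.
exists (vertex h (rcons u (~~ b))); first by rewrite vertexK size_rcons uj.
move=> k nk kn; have sk := new_vertices_notin ns nk kn.
have := Hu k nk kn; rewrite !inE vertexK ?size_rcons//.
have sb : prefix (rcons u b) (nth (bintree_root h) s k) = false.
  apply: contraNF sk => pb; apply: (fintype.subsetP fb); by rewrite inE.
move=> pu; have su : bseqval u != nth (bintree_root h) s k.
  by apply: contraNneq sk => E; rewrite (_ : nth _ _ _ = u)//; exact: val_inj.
have := prefix_child pu su; case: b {fb uo} sb => /= ->; last by rewrite add0n; case: prefix.
by rewrite addn0; case: prefix.
Qed.

End LastParticles.

Section TreeBounds.
Variable h : nat.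
Context {R : realType} {d : measure_display} {Omega : measurableType d}.
Context {P : probability Omega R}.
Local Notation V := (bintree_vertex h).
Local Notation edge := (@bintree_edge h).
Local Notation root := (bintree_root h).
Local Notation n := #|V|.
Variable X : nat -> nat -> Omega -> V.
Hypothesis idlaX : idla_walks P edge root X.

(** The potential is [race_at]. The root lies in neither branch, so [race_walk] starts at
    [race_at A]; at the settling vertex [x] it equals [race_at] of [x |: A]. Superharmonicity thus
    makes [race_at] a supermartingale until a side is full, when it becomes the indicator of a bad
    end. *)
Lemma sum_bad_history_le (u : V) (m : nat) : (size u < h)%N ->
  \sum_(s : n.-tuple V | has_step (bad_step m u) finset.set0 s)
     pr P (history_event root X s) <= h%:R * m%:R / Num.sqrt (2 ^ (h - (size u).+1))%:R.
Proof.
move=> uh; pose p := srw_kernel R edge.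
have subp : substochastic p by exact: srw_kernel_sub.
pose L b := subtree h (rcons u b); pose l b := vertex h (rcons u b).
have br b : branch p u (l b) (L b) by exact: subtree_branch.
have h0 : 0 < h%:R :> R by rewrite ltr0n (leq_ltn_trans _ uh).
have dL : ([disjoint L false & L true])%B by exact: subtree_disjoint.
have pc : p u (l false) = p u (l true) by exact: srw_kernel_children.
have cL b : (2 ^ (h - (size u).+1) <= #|L b|)%N.
  by rewrite -(size_rcons u b); apply: card_subtree_ge; rewrite size_rcons.
have M0 : (0 < 2 ^ (h - (size u).+1))%N by rewrite expn_gt0.
have es b (A : {set V}) : ~~ (L b \subset A) ->
  \sum_(x | x \notin (L b :\: A)%SET) hit p (A :&: L b)%SET (l b) x <= 1 - h%:R^-1.
  exact: subtree_escape.
have rL b : root \notin L b.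
  by rewrite inE; apply/negP => /size_prefix; rewrite size_rcons.
have S0 := @race_at_set0 R V p (l false) (l true) (L false) (L true) _ m _ subp
  M0 (cL false) (cL true) h0 (es false) (es true).
apply: le_trans S0.
apply: (sum_history_has_step idlaX (good := fun A => ~~ full_side u A)).
- by move=> A; exact: race_at_ge0.
- move=> k A kn; rewrite negb_or => /andP[nL nQ].
  have sup := @race_walk_superharmonic R V p u (l false) (l true) (L false) (L true) m
    subp (br false) (br true) dL pc A _ nL nQ.
  pose g := race_walk p (l false) (l true) (L false) (L true) m A.
  have g0 x : 0 <= g x by exact: race_walk_ge0.
  have := settle_prob_le idlaX kn g0 sup.
  rewrite {2}/g /race_walk (negPf (rL _)) (negPf (rL _)); apply: le_trans.
  apply: ler_sum => x _; have [xA|xA] := boolP (x \in A).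
    by rewrite settle_prob_occupied// !mul0r.
  by rewrite /g race_walk_out.
- move=> A A' /and4P[_ fA' s1 s2].
  by rewrite race_at_full// s1 s2.
- by move=> A s; rewrite negbK; exact: has_step_full.
Qed.

(** The target is fixed and the walks are followed beyond settling, so these events are independent
    whatever the earlier particles do. *)
Lemma pr_last_particles_hit (u : V) (lam : R) (N m : nat) : (1 < h)%N -> (0 < size u)%N ->
  lam = ((size u)%:R * (2 ^+ h.+1 - 3))^-1 -> (m <= n)%N ->
  pr P (\bigcap_(k in [set` [set k : 'I_n | (n - m <= k)%N]%SET])
    ~` [set om | forall t, (t < N.+1)%N -> X k t om \in (~: subtree h u)%SET])
  <= (1 - (1 - lam) ^+ N / 5) ^+ m.
Proof.
move=> h1 u0 lamE mn; have [srwX indX] := idlaX.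
have mst (k : 'I_n) :
    measurable [set om | forall t, (t < N.+1)%N -> X k t om \in (~: subtree h u)%SET].
  by apply: measurable_walk_forall => t x; have [mk _ _] := srwX k (ltn_ord k).
rewrite (pr_bigcap_independent _ indX).
- have cm : #|[set k : 'I_n | (n - m <= k)%N]%SET| = m.
    rewrite -sum1_card (eq_bigl (fun k : 'I_n => (n - m <= k)%N)) => [|k]; last by rewrite inE.
    rewrite -(big_mkord (fun k => predT k && (n - m <= k)%N) (fun=> 1%N)) -big_nat_widenl//.
    by rewrite sum_nat_const_nat muln1 subKn.
  rewrite -[X in _ ^+ X]cm -prodr_const; apply: ler_prod => k _.
  rewrite pr_ge0/= pr_setC// lerD2l lerN2.
  rewrite ler_pdivrMr// mulrC.
  exact: (subtree_survival (srwX k (ltn_ord k)) N h1 u0 lamE).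
- by move=> k; exact: measurableC.
- by move=> k; exact: process_sigma_leaves.
Qed.

Lemma card_depth_le (j : nat) (Q : pred V) : (forall u, Q u -> (size u <= j)%N) ->
  #|Q|%:R <= 2 ^+ j.+1 :> R.
Proof.
move=> Qj; rewrite -natrX ler_nat.
apply: (@leq_trans #|bintree_vertex j|); last by rewrite card_bintree_vertex leq_subr.
have inj : {in Q &, injective (fun u : V => vertex j u)}.
  move=> u u' Qu Qu' /(congr1 (@bseqval _ _)); rewrite !vertexK ?Qj//.
  by move=> E; exact: val_inj.
by rewrite -(card_in_image inj) max_card.
Qed.

Lemma pr_dispersion_lt (c : R) (N j m : nat) : 0 < c -> c <= N.+1%:R ->
  (0 < j)%N -> (j <= h)%N -> (1 < h)%N -> (m <= n)%N ->
  pr P (~` [set om | (c%:E <= dispersion_time R (fun k t => X k t om))%E]) <=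
  2 ^+ j.+1 * (h%:R * m%:R / Num.sqrt (2 ^ (h - j))%:R) +
  2 ^+ j.+1 * (1 - (1 - (j%:R * (2 ^+ h.+1 - 3))^-1) ^+ N / 5) ^+ m.
Proof.
move=> c0 cN j0 jh h1 mn.
have mD := measurable_dispersion idlaX c0.
pose lam : R := (j%:R * (2 ^+ h.+1 - 3))^-1.
pose hist (s : n.-tuple V) := history_event root X s.
have mhist s : measurable (hist s) by exact: (measurable_history_event idlaX).
pose hits (u : V) := \bigcap_(k in [set` [set k : 'I_n | (n - m <= k)%N]%SET])
    ~` [set om | forall t, (t < N.+1)%N -> X k t om \in (~: subtree h u)%SET].
have mhits u : measurable (hits u).
  apply: fin_bigcap_measurable => // k _; apply: measurableC.
  have [srwX _] := idlaX.
  by apply: measurable_walk_forall => t x; have [mk _ _] := srwX k (ltn_ord k).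
pose E1 := \bigcup_(s in [set s : n.-tuple V | ~~ connected_history edge root s]) hist s.
pose E2 (u : V) :=
  \bigcup_(s in [set s : n.-tuple V | has_step (bad_step m u) finset.set0 s]) hist s.
pose E2' := \bigcup_(u in [set u : V | (size u < j)%N]) E2 u.
pose E3 := \bigcup_(u in [set u : V | size u == j]) hits u.
have mE1 : measurable E1 by apply: fin_bigcup_measurable.
have mE2 u : measurable (E2 u) by apply: fin_bigcup_measurable.
have mE2' : measurable E2' by apply: fin_bigcup_measurable.
have mE3 : measurable E3 by apply: fin_bigcup_measurable.
(* If all particles settle before time [c], then the history is disconnected, or a race above depth
   [j] ends badly, or the last [m] particles settle in one subtree of depth [j], which their walks
   therefore visit at a time at most [N]. *)
have sub : ~` [set om | (c%:E <= dispersion_time R (fun k t => X k t om))%E]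
    `<=` E1 `|` (E2' `|` E3).
  rewrite (dispersion_lt root X c0) => om [s /= ns qs].
  have hs : hist s om.
    move=> k _; have ks : nth root s k \notin occupied_by s k by exact: (forallP ns).
    exact: (quick_settle_event ks (qs k I)).
  have [cs|cs] := boolP (connected_history edge root s); last by left; exists s.
  right; have [/forallP nb|] := boolP
    [forall u : V, (size u < j)%N ==> ~~ has_step (bad_step m u) finset.set0 s]; last first.
    rewrite negb_forall => /existsP[u]; rewrite negb_imply negbK => /andP[uj bu].
    by left; exists u => //; exists s.
  right; have [|u uj Hu] := @last_in_subtree h m s j ns cs mn jh.
    by move=> u uj; exact: (implyP (nb u)).
  exists u; first exact/eqP.
  move=> k /=; rewrite inE => nk; have [t /= tc [_ tx]] := qs k I.
  apply/existsNP; exists t; apply/not_implyP; split.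
    by rewrite -(ltr_nat R); exact: lt_le_trans cN.
  by rewrite tx inE Hu.
have le1 : pr P E1 <= 0.
  apply: (@le_trans _ _ (\sum_(s : n.-tuple V | ~~ connected_history edge root s) pr P (hist s))).
    by apply: pr_union_le => // om [s]; exists s.
  rewrite big1// => s cs; apply: (pr_disconnected_history idlaX) => //.
  exact: size_tuple.
have le2 : pr P E2' <= 2 ^+ j.+1 * (h%:R * m%:R / Num.sqrt (2 ^ (h - j))%:R).
  apply: (@le_trans _ _ (\sum_(u : V | (size u < j)%N) pr P (E2 u))).
    by apply: pr_union_le => // om [u]; exists u.
  apply: (@le_trans _ _ (\sum_(u : V | (size u < j)%N) (h%:R * m%:R / Num.sqrt (2 ^ (h - j))%:R))).
    apply: ler_sum => u uj; have uh : (size u < h)%N by exact: leq_trans jh.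
    apply: (@le_trans _ _ (
      \sum_(s : n.-tuple V | has_step (bad_step m u) finset.set0 s) pr P (hist s))).
      by apply: pr_union_le => // om [s]; exists s.
    apply: le_trans (sum_bad_history_le m uh) _.
    rewrite ler_wpM2l ?mulr_ge0// lef_pV2 ?posrE ?sqrtr_gt0 ?ltr0n ?expn_gt0//.
    by rewrite ler_wsqrtr// ler_nat leq_exp2l// leq_sub2l.
  rewrite sumr_const -[_ *+ _]mulr_natl ler_wpM2r ?divr_ge0 ?mulr_ge0 ?sqrtr_ge0//.
  by apply: card_depth_le => u /ltnW.
have le3 : pr P E3 <= 2 ^+ j.+1 * (1 - (1 - lam) ^+ N / 5) ^+ m.
  apply: (@le_trans _ _ (\sum_(u : V | size u == j) pr P (hits u))).
    by apply: pr_union_le => // om [u]; exists u.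
  pose r := (1 - (1 - lam) ^+ N / 5) ^+ m.
  have hr (u : V) : size u == j -> pr P (hits u) <= r.
    move=> /eqP uj; apply: pr_last_particles_hit => //; first by rewrite uj.
    by rewrite uj.
  (* Some vertex of depth [j] is produced so that [0 <= r] can be read off from a probability
     bounded by [r]. *)
  have [w wj] : exists w : V, size w == j.
    by exists (vertex h (nseq j true)); rewrite vertexK size_nseq.
  have r0 : 0 <= r by apply: le_trans (hr w wj); exact: pr_ge0.
  apply: (@le_trans _ _ (\sum_(u : V | size u == j) r)); first by apply: ler_sum.
  rewrite sumr_const -[_ *+ _]mulr_natl ler_wpM2r//.
  by apply: card_depth_le => u /eqP ->.
have mU : measurable (E2' `|` E3) by exact: measurableU.
apply: (@le_trans _ _ (pr P (E1 `|` (E2' `|` E3)))).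
  by apply: pr_le => //; [exact: measurableC|exact: measurableU].
apply: le_trans (pr_setU_le P mE1 mU) _.
rewrite -[leRHS]add0r; apply: lerD => //.
by apply: le_trans (pr_setU_le P mE2' mE3) _; exact: lerD.
Qed.

End TreeBounds.

(** * Numerical estimates *)

Section Numerics.
Context {R : realType}.

Lemma bernoulli_inequality (x : R) M : 0 <= x <= 1 -> 1 - M%:R * x <= (1 - x) ^+ M.
Proof.
move=> /andP[x0 x1]; elim: M => [|M IH]; first by rewrite expr0 mul0r subr0.
rewrite exprS; apply: le_trans (ler_wpM2l _ IH); last by lra.
have : 0 <= M%:R :> R by [].
rewrite -natr1; nra.
Qed.

Lemma expr_onem_le (x : R) M : 0 <= x <= 1 -> (1 - x) ^+ M * (1 + M%:R * x) <= 1.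
Proof.
move=> /andP[x0 x1]; elim: M => [|M IH]; first by rewrite expr0 mul0r addr0 mul1r.
apply: le_trans IH; rewrite exprSr -mulrA ler_wpM2l ?exprn_ge0 ?subr_ge0//.
have : 0 <= M%:R :> R by [].
rewrite -natr1; nra.
Qed.

(** A block of [j * 2 ^ (h - 2)] steps keeps a factor of at least one half by Bernoulli's
    inequality, and [N] is covered by [j] blocks. *)
Lemma survival_exponent (h j N : nat) : (1 < h)%N -> (0 < j)%N -> (N <= j * 2 ^ (h - 2) * j)%N ->
  (2 ^+ j)^-1 <= (1 - (j%:R * (2 ^+ h.+1 - 3))^-1 : R) ^+ N <= 1.
Proof.
move=> h1 j0 NM; set lam := (_ * _)^-1.
have j1 : 1 <= j%:R :> R by rewrite ler1n.
have hE : 2 ^+ h.+1 = 8 * 2 ^+ (h - 2) :> R.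
  by rewrite -[in LHS](subnK h1) -addnS exprD mulrC; congr (_ * _); rewrite !exprS; ring.
have q1 : 1 <= 2 ^+ (h - 2) :> R by rewrite exprn_ege1// ler1n.
have pos : 0 < j%:R * (2 ^+ h.+1 - 3) :> R by rewrite hE; nra.
have lam01 : 0 <= lam <= 1.
  by apply/andP; split; [rewrite /lam invr_ge0 ltW|rewrite /lam invf_le1// hE; nra].
have half : 2^-1 <= (1 - lam) ^+ (j * 2 ^ (h - 2)).
  apply: le_trans (bernoulli_inequality _ lam01); rewrite natrM natrX.
  have : j%:R * 2 ^+ (h - 2) * lam <= 2^-1.
    by rewrite /lam ler_pdivrMr// hE; nra.
  lra.
have /andP[l0 l1] := lam01; apply/andP; split; last first.
  by rewrite exprn_ile1 ?subr_ge0// gerBl.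
apply: (@le_trans _ _ ((1 - lam) ^+ (j * 2 ^ (h - 2) * j))).
  rewrite [X in _ <= X]exprM -exprVn; apply: lerXn2r half; rewrite nnegrE ?invr_ge0//.
  by rewrite exprn_ge0// subr_ge0.
by apply: ler_wiXn2l NM; [rewrite subr_ge0|rewrite gerBl].
Qed.

(** With [z = 2 ^ j], the first term is at most [32 / z ^ 2] and the second at most [10 / z], whence
    the constant 42. The bound [h <= 16 z] comes from [j + 1 <= 2 ^ j]. *)
Lemma error_bound (h j : nat) (q : R) : (0 < j)%N -> (16 * j <= h)%N -> (h <= 16 * j.+1)%N ->
  (2 ^+ j)^-1 <= q -> q <= 1 ->
  2 ^+ j.+1 * (h%:R * (2 ^ (3 * j))%:R / Num.sqrt (2 ^ (h - j))%:R) +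
  2 ^+ j.+1 * (1 - q / 5) ^+ (2 ^ (3 * j)) <= 42 / 2 ^+ j.
Proof.
move=> j0 jh hj zq q1; pose z : R := 2 ^+ j.
have z2 : 2 <= z by rewrite /z -{1}(expr1 2) ler_weXn2l// ler1n.
have z0 : 0 < z by lra.
have sq : z ^+ 7 <= Num.sqrt (2 ^ (h - j))%:R.
  have -> : z ^+ 7 = Num.sqrt ((z ^+ 7) ^+ 2) by rewrite sqrtr_sqr ger0_norm// exprn_ge0// ltW.
  rewrite ler_wsqrtr// /z -!exprM natrX ler_weXn2l ?ler1n//.
  lia.
have hz : h%:R <= 16 * z.
  apply: (@le_trans _ _ (16 * j.+1)%:R); first by rewrite ler_nat.
  by rewrite natrM ler_wpM2l// /z -natrX ler_nat; exact: ltn_expl.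
have mz : (2 ^ (3 * j))%:R = z ^+ 3 :> R by rewrite natrX mulnC exprM.
rewrite exprS -/z mz.
have t1 : h%:R * z ^+ 3 / Num.sqrt (2 ^ (h - j))%:R <= 16 / z ^+ 3.
  have -> : 16 / z ^+ 3 = 16 * z * z ^+ 3 / z ^+ 7 by field; rewrite gt_eqF.
  apply: ler_pM; rewrite ?mulr_ge0 ?invr_ge0 ?sqrtr_ge0 ?exprn_ge0 ?(ltW z0)//.
    by rewrite ler_wpM2r ?exprn_ge0 ?(ltW z0).
  by rewrite lef_pV2 ?posrE ?exprn_gt0// (lt_le_trans _ sq)// exprn_gt0.
have t2 : (1 - q / 5) ^+ (2 ^ (3 * j)) <= 5 / z ^+ 2.
  pose b : R := (1 - (5 * z)^-1) ^+ (2 ^ (3 * j)).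
  have x01 : 0 <= (5 * z)^-1 <= 1.
    by apply/andP; split; [rewrite invr_ge0; lra|rewrite invf_le1; lra].
  have wb : (1 - q / 5) ^+ (2 ^ (3 * j)) <= b.
    apply: lerXn2r; rewrite ?nnegrE ?subr_ge0; [lra|by case/andP: x01|].
    by rewrite invfM lerD2l lerN2 mulrC ler_wpM2r.
  apply: le_trans wb _; have := expr_onem_le (2 ^ (3 * j)) x01; rewrite -/b mz.
  have b0 : 0 <= b by rewrite exprn_ge0// subr_ge0; case/andP: x01.
  have -> : z ^+ 3 / (5 * z) = z ^+ 2 / 5 by field; rewrite gt_eqF.
  rewrite ler_pdivlMr ?exprn_gt0//; set y := z ^+ 2; have : 0 <= y by rewrite exprn_ge0// ltW.
  nra.
have a1 : 2 * z * (h%:R * z ^+ 3 / Num.sqrt (2 ^ (h - j))%:R) <= 2 * z * (16 / z ^+ 3).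
  by rewrite ler_wpM2l//; lra.
have a2 : 2 * z * (1 - q / 5) ^+ (2 ^ (3 * j)) <= 2 * z * (5 / z ^+ 2).
  by rewrite ler_wpM2l//; lra.
apply: le_trans (lerD a1 a2) _.
have -> : 2 * z * (16 / z ^+ 3) + 2 * z * (5 / z ^+ 2) = (32 / z + 10) / z.
  by field; rewrite gt_eqF.
rewrite ler_pM2r ?invr_gt0//.
have : 32 / z <= 16 by rewrite ler_pdivrMr//; lra.
lra.
Qed.

End Numerics.

Theorem theorem5p13 (R : realType) :
  exists2 c : R, 0 < c &
    forall eps : R, 0 < eps ->
      \forall h \near \oo,
        forall (d : measure_display) (Omega : measurableType d)
          (P : probability Omega R)
          (X : nat -> nat -> Omega -> bintree_vertex h),
          idla_walks P (@bintree_edge h) (bintree_root h) X ->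
          let n : R := #|bintree_vertex h|%:R in
          ((1 - eps)%:E <=
             P [set om | ((c * n * ln n ^+ 2)%:E <=
                   dispersion_time R (fun k t => X k t om))%E])%E.
Proof.
(* The time must not exceed [j ^ 2 * 2 ^ (h - 2)]. As [n <= 8 * 2 ^ (h - 2)] and [ln n <= 64 j], the
   constant has to absorb [8 * 64 ^ 2 = 2 ^ 15]. *)
exists (2 ^+ 15)^-1; first by rewrite invr_gt0 exprn_gt0.
(* For [j >= J] one has [2 ^ j >= 42 / eps], so the total error [42 / 2 ^ j] is at most [eps]. *)
move=> eps eps0; pose J := (Num.trunc (42 / eps)).+1.
apply: (filterS _ (nbhs_infty_ge (16 * J))) => h hJ d Omega P X idlaX. set n : R := _%:R; cbv zeta.
pose j := (h %/ 16)%N; pose c := (2 ^+ 15)^-1 * n * ln n ^+ 2.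
have Jj : (J <= j)%N by rewrite /j leq_divRL// mulnC.
have j0 : (0 < j)%N by exact: leq_trans Jj.
have h16 : (16 <= h)%N by apply: leq_trans hJ; rewrite leq_pmulr.
have jh : (16 * j <= h)%N by rewrite mulnC leq_divM.
have hj : (h < 16 * j.+1)%N by rewrite mulnC ltn_ceil.
have h1 : (1 < h)%N by exact: leq_trans h16.
have nE : n = 2 ^+ h.+1 - 1.
  by rewrite /n card_bintree_vertex natrB ?expn_gt0// natrX.
have n2 : 2 <= n.
  have : (2 ^ 2)%:R <= (2 ^ h.+1)%:R :> R by rewrite ler_nat leq_exp2l// ltnW.
  by rewrite !natrX nE; lra.
have ln0 : 0 < ln n by apply: ln_gt0; lra.
have c0 : 0 < c.
  by rewrite /c !mulr_gt0 ?invr_gt0 ?exprn_gt0//; lra.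
have lnh : ln n <= 2 * h.+1%:R.
  apply: (@le_trans _ _ (ln (2 ^+ h.+1))).
    by rewrite ler_ln ?posrE ?exprn_gt0// nE; lra.
  rewrite lnXn// -[leLHS]mulr_natr ler_wpM2r// ltW//.
  exact: ln_sublinear.
have /andP[Nc cN] := truncn_itv (ltW c0); set N := Num.trunc c in Nc cN.
have NM : (N <= j * 2 ^ (h - 2) * j)%N.
  rewrite -(ler_nat R); apply: le_trans Nc _.
  rewrite !natrM natrX /c.
  have hE : 2 ^+ h.+1 = 8 * 2 ^+ (h - 2) :> R.
    by rewrite -[in LHS](subnK h1) -addnS exprD mulrC; congr (_ * _); rewrite !exprS; ring.
  have hj' : h.+1%:R <= 32 * j%:R :> R by rewrite -natrM ler_nat; lia.
  have l2 : ln n ^+ 2 <= (64 * j%:R) ^+ 2.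
    by apply: lerXn2r; rewrite ?nnegrE ?(ltW ln0) ?mulr_ge0//; lra.
  have nq : n <= 8 * 2 ^+ (h - 2) by rewrite nE hE; lra.
  apply: (@le_trans _ _ ((2 ^+ 15)^-1 * (8 * 2 ^+ (h - 2)) * (64 * j%:R) ^+ 2)).
    apply: ler_pM l2; [|exact: exprn_ge0 (ltW ln0)|].
      by rewrite mulr_ge0 ?invr_ge0 ?exprn_ge0//; lra.
    by apply: ler_wpM2l nq; rewrite invr_ge0 exprn_ge0.
  by rewrite le_eqVlt; apply/orP; left; apply/eqP; field; rewrite ?expf_neq0.
have mn : (2 ^ (3 * j) <= #|bintree_vertex h|)%N.
  rewrite card_bintree_vertex; apply: (@leq_trans (2 ^ h)).
    by rewrite leq_exp2l// (leq_trans _ jh)// leq_mul2r orbT.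
  by rewrite expnS mul2n -addnn -addnBA ?expn_gt0// leq_addr.
have jh' : (j <= h)%N by apply: leq_trans jh; exact: leq_pmull.
have mD := measurable_dispersion idlaX c0.
have B := pr_dispersion_lt idlaX c0 (ltW cN) j0 jh' h1 mn.
have /andP[surv surv1] := survival_exponent (R := R) h1 j0 NM.
have E := error_bound j0 jh (ltnW hj) surv surv1.
have lim : 42 / 2 ^+ j <= eps.
  have /andP[_ J42] := truncn_itv (ltW (divr_gt0 (ltr0n R 42) eps0)).
  rewrite ler_pdivrMr ?exprn_gt0// mulrC -ler_pdivrMr//; apply: le_trans (ltW J42) _.
  by rewrite -natrX ler_nat (leq_trans Jj)// ltnW// ltn_expl.
rewrite prE// lee_fin lerBlDr -lerBlDl -pr_setC//.
exact: le_trans (le_trans B E) lim.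
Qed.
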